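(* Let $1<p<\infty$ and let $q$ be defined by $1/p+1/q=1$. The inclusions $$\mathcal{A}^{1/q}\subseteq\mathcal{M}(\mathcal{H}(ces_p))\subsetneq\mathcal{H}^\infty(\mathbb{C}_{1/q})$$ hold (the second one being proper), and both are continuous with inclusion constants equal to one.
   Context: For $\theta\in\mathbb{R}$, $\mathbb{C}_\theta:=\{s\in\mathbb{C}:\Re(s)>\theta\}$. For $1<p<\infty$, the Ces\`aro sequence space $ces_p$ consists of all complex sequences $(a_n)_{n=1}^\infty$ with $$\|(a_n)_{n=1}^\infty\|_{ces_p}:=\Big(\sum_{n=1}^\infty\Big(\frac1n\sum_{k=1}^n|a_k|\Big)^p\Big)^{1/p}<\infty.$$ $\mathcal{H}(ces_p)$ is the Banach space of all Dirichlet series $f(s)=\sum_{n=1}^\infty a_nn^{-s}$ with $(a_n)_{n=1}^\infty\in ces_p$, with norm $\|f\|_{\mathcal{H}(ces_p)}:=\|(a_n)_{n=1}^\infty\|_{ces_p}$. Every such $f$ converges absolutely, hence is analytic, on $\mathbb{C}_{1/q}$. A multiplier on $\mathcal{H}(ces_p)$ is an analytic function $f$ on $\mathbb{C}_{1/q}$ such that $fg\in\mathcal{H}(ces_p)$ for every $g\in\mathcal{H}(ces_p)$ (pointwise product; in terms of coefficients it is the Dirichlet convolution $(a\cdot b)_n=\sum_{k|n}a_kb_{n/k}$). $\mathcal{M}(\mathcal{H}(ces_p))$ is the set of all multipliers on $\mathcal{H}(ces_p)$; it is contained in $\mathcal{H}(ces_p)$, each multiplier $f$ defines a bounded operator $M_f:g\mapsto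 fg$ on $\mathcal{H}(ces_p)$, and $\|f\|_{\mathcal{M}(\mathcal{H}(ces_p))}$ denotes the operator norm of $M_f$. For $r\in\mathbb{R}$, $\mathcal{A}^r$ is the space of all Dirichlet series $f(s)=\sum_{n=1}^\infty a_nn^{-s}$ with $\|f\|_{\mathcal{A}^r}:=\sum_{n=1}^\infty|a_n|n^{-r}<\infty$. $\mathcal{H}^\infty(\mathbb{C}_r)$ is the space of all bounded analytic functions on $\mathbb{C}_r$ which can be represented as a Dirichlet series in some vertical half-plane, with norm $\|f\|_{\mathcal{H}^\infty(\mathbb{C}_r)}:=\sup_{s\in\mathbb{C}_r}|f(s)|$. An inclusion $X\subseteq Y$ being continuous with constant one means $\|f\|_Y\le\|f\|_X$ for all $f\in X$. *)

(* Defs.v *)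
(** Stdlib reals with Coquelicot.

    A function on a half-plane [C_theta] is a total function [f : C -> C] of
    which only the values at points of [C_theta] are ever used.  A coefficient
    sequence [(a_n)_{n >= 1}] is a function [a : nat -> C] where [a n] is the
    coefficient of [(n+1)^{-s}]. *)
From Stdlib Require Import Reals ClassicalEpsilon.
From Coquelicot Require Import Coquelicot.
Open Scope R_scope.

Definition half_plane (theta : R) (s : C) : Prop := theta < Re s.

Definition Cexp (z : C) : C := (exp (Re z) * cos (Im z), exp (Re z) * sin (Im z)).

(** [(n+1)^{-s}] *)
Definition dpow (n : nat) (s : C) : C :=
  Cexp (Cmult (Copp s) (RtoC (ln (INR (S n))))).

(** Real powers of nonnegative reals with positive exponent: [Rpower 0 y] is
    [1], whereas [0^y] has to be [0]. *)
Definition rpow (x y : R) : R :=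
  if Rle_dec x 0 then 0 else Rpower x y.

Definition analytic_on (theta : R) (f : C -> C) : Prop :=
  forall s : C, half_plane theta s ->
    ex_derive (K := C_AbsRing) (V := C_NormedModule) f s.

(** [f] is the sum of the Dirichlet series with coefficients [a] on [C_theta]. *)
Definition represents (theta : R) (a : nat -> C) (f : C -> C) : Prop :=
  forall s : C, half_plane theta s ->
    is_series (K := C_AbsRing) (V := C_NormedModule)
      (fun n : nat => Cmult (a n) (dpow n s)) (f s).

(** The coefficients of a Dirichlet series, unique whenever they exist; the
    value is arbitrary if [f] is not a Dirichlet series on [C_theta]. *)
Definition dcoef (theta : R) (f : C -> C) : nat -> C :=
  epsilon (inhabits (fun _ : nat => RtoC 0))
    (fun a : nat -> C => represents theta a f).

Definition ces_term (p : R) (a : nat -> C) (n : nat) : R :=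
  rpow (/ INR (S n) * sum_n (fun k : nat => Cmod (a k)) n) p.

Definition in_ces (p : R) (a : nat -> C) : Prop := ex_series (ces_term p a).

Definition ces_norm (p : R) (a : nat -> C) : R :=
  rpow (Series (ces_term p a)) (1 / p).

(** In the definitions involving both [p] and [q], [q] is meant to be the
    conjugate exponent of [p]. *)
Definition in_Hces (p q : R) (f : C -> C) : Prop :=
  exists a : nat -> C, in_ces p a /\ represents (1 / q) a f.

Definition Hces_norm (p q : R) (f : C -> C) : R :=
  ces_norm p (dcoef (1 / q) f).

Definition Cfun_mult (f g : C -> C) (s : C) : C := Cmult (f s) (g s).

Definition multiplier (p q : R) (f : C -> C) : Prop :=
  analytic_on (1 / q) f /\
  forall g : C -> C, in_Hces p q g -> in_Hces p q (Cfun_mult f g).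

(** Operator norm of [g |-> f g], as a supremum in the extended reals. *)
Definition multiplier_norm (p q : R) (f : C -> C) : Rbar :=
  Lub_Rbar (fun x : R => exists g : C -> C,
    in_Hces p q g /\ Hces_norm p q g <= 1 /\
    x = Hces_norm p q (Cfun_mult f g)).

Definition A_term (r : R) (a : nat -> C) (n : nat) : R :=
  Cmod (a n) * Rpower (INR (S n)) (- r).

Definition in_A (r : R) (f : C -> C) : Prop :=
  exists a : nat -> C, ex_series (A_term r a) /\ represents r a f.

Definition A_norm (r : R) (f : C -> C) : R := Series (A_term r (dcoef r f)).

Definition in_Hinf (r : R) (f : C -> C) : Prop :=
  analytic_on r f /\
  (exists B : R, forall s : C, half_plane r s -> Cmod (f s) <= B) /\
  (exists (theta : R) (a : nat -> C), r <= theta /\ represents theta a f).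

Definition Hinf_norm (r : R) (f : C -> C) : Rbar :=
  Lub_Rbar (fun x : R => exists s : C, half_plane r s /\ x = Cmod (f s)).

(* Main.v *)
(** Write [t = 1/q].  The map [g |-> k^(-s) g] has norm at most [k^(-t)] on [H(ces_p)],
    so Jensen's inequality for [x^p] bounds a convolution by [a] by the [A^t] norm
    of [a].  Conversely a gliding hump shows that a multiplier [f] acts boundedly,
    say with norm [M]; point evaluations being bounded, [|f(s)|^k <= C_s M^k] for
    all [k], whence [|f(s)| <= M].

    The second inclusion is proper because Dirichlet series in [ces_p] converge
    absolutely with [sum_(k<=n) |a_k| = O(n^t)].  Rudin-Shapiro polynomials [P_r]
    with [2^r] unimodular coefficients at frequencies in a dyadic block
    [[A_r, 2 A_r)] satisfy [|P_r| <= 2^((r+1)/2)] on [Re s >= 0], so that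
    [sum_r (2/3)^r P_r(s - t)] is bounded on [Re s > t], since [(2/3) sqrt 2 < 1],
    but violates the growth condition, since [(2/3) 2 > 1]. *)
Require Import Defs.
From Stdlib Require Import Arith Reals Lra Lia Psatz Classical ClassicalEpsilon FunctionalExtensionality.
From Coquelicot Require Import Coquelicot.
Open Scope R_scope.

(** * Finite sums, series and real powers *)

(** The estimates on [ces_p] are made on [sum_n (ces_term p b) N], the [p]-th power of a truncated
    norm, so that they make sense before convergence is known. Jensen's inequality also takes the
    place of Minkowski's: weights of total mass [W] cost [W^(p-1)]. This is sharp for convolutions,
    and it leaves a quasi-triangle inequality with factor [2^(p-1)], harmless in the gliding hump.
    The hump yields some finite bound, with no control of its size: enough for membership in
    [H^infinity], while the inequality of norms feeds the supremum itself to the same power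
    argument. Norms of functions go through coefficients selected by [epsilon], so uniqueness of
    Dirichlet coefficients underlies every norm computation. Any ratio strictly between [1/2] and
    [1/sqrt 2] could replace [2/3]. Classical Rudin-Shapiro polynomials separate their halves by
    shifting frequencies; for Dirichlet series the operation with a simple effect on values is
    dilation, so the halves are dilated by the two integers that follow the block, which keeps the
    block dyadic. *)

Lemma sum_n_S (u : nat -> R) (n : nat) : sum_n u (S n) = sum_n u n + u (S n).
Proof. rewrite sum_Sn. reflexivity. Qed.

Lemma sum_n_add (u v : nat -> R) (n : nat) :
  sum_n (fun k => u k + v k) n = sum_n u n + sum_n v n.
Proof. apply (sum_n_plus (G := R_AbelianMonoid) u v n). Qed.

Lemma sum_n_scal (c : R) (u : nat -> R) (n : nat) :
  sum_n (fun k => c * u k) n = c * sum_n u n.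
Proof. apply (sum_n_mult_l (K := R_Ring) c u n). Qed.

Lemma sum_n_le (u v : nat -> R) (n : nat) :
  (forall k, (k <= n)%nat -> u k <= v k) -> sum_n u n <= sum_n v n.
Proof.
  intros H; induction n as [|n IH].
  - rewrite !sum_O; auto.
  - rewrite !sum_n_S. apply Rplus_le_compat; auto.
Qed.

Lemma sum_n_zero {G : AbelianMonoid} (u : nat -> G) (n : nat) :
  (forall k, (k <= n)%nat -> u k = zero) -> sum_n u n = zero.
Proof.
  intros H; induction n as [|n IH].
  - rewrite sum_O; auto.
  - rewrite sum_Sn, IH, H, plus_zero_l; auto.
Qed.

Lemma sum_n_ge0 (u : nat -> R) (n : nat) :
  (forall k, (k <= n)%nat -> 0 <= u k) -> 0 <= sum_n u n.
Proof.
  intros H. apply Rle_trans with (sum_n (fun _ : nat => 0) n).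
  - right. symmetry. apply (sum_n_zero (G := R_AbelianMonoid)); reflexivity.
  - apply sum_n_le; auto.
Qed.

Lemma sum_n_le_n (u : nat -> R) (n m : nat) :
  (forall k, 0 <= u k) -> (n <= m)%nat -> sum_n u n <= sum_n u m.
Proof.
  intros H; induction 1 as [|m _ IH]; [lra|].
  rewrite sum_n_S. specialize (H (S m)). lra.
Qed.

Lemma sum_n_extend {G : AbelianMonoid} (u : nat -> G) (n N : nat) :
  (n <= N)%nat -> (forall k, (n < k <= N)%nat -> u k = zero) ->
  sum_n u N = sum_n u n.
Proof.
  induction 1 as [|N HN IH]; intros H; auto.
  rewrite sum_Sn, H, plus_zero_r by lia. apply IH; intros; apply H; lia.
Qed.

Lemma sum_n_single {G : AbelianMonoid} (u : nat -> G) (i N : nat) :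
  (i <= N)%nat -> (forall k, (k <= N)%nat -> k <> i -> u k = zero) ->
  sum_n u N = u i.
Proof.
  intros Hi H. rewrite (sum_n_extend u i N Hi) by (intros; apply H; lia).
  destruct i as [|i]; [apply sum_O|].
  rewrite sum_Sn, sum_n_zero, plus_zero_l; auto. intros; apply H; lia.
Qed.

Lemma sum_n_term_le (u : nat -> R) (i N : nat) :
  (forall k, 0 <= u k) -> (i <= N)%nat -> u i <= sum_n u N.
Proof.
  intros H Hi. apply Rle_trans with (sum_n u i); [|apply sum_n_le_n; auto].
  destruct i; [rewrite sum_O; lra|]. rewrite sum_n_S.
  generalize (sum_n_ge0 u i (fun k _ => H k)); lra.
Qed.

Lemma Cmod_sum_n (u : nat -> C) (n : nat) :
  Cmod (sum_n u n) <= sum_n (fun k => Cmod (u k)) n.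
Proof.
  induction n as [|n IH].
  - rewrite !sum_O; lra.
  - rewrite sum_n_S, sum_Sn. eapply Rle_trans; [apply Cmod_triangle|]. lra.
Qed.

Lemma sum_n_Series_le (u : nat -> R) (n : nat) :
  (forall k, 0 <= u k) -> ex_series u -> sum_n u n <= Series u.
Proof.
  intros H Hu.
  assert (L : is_lim_seq (sum_n u) (Series u)) by exact (Series_correct u Hu).
  refine (is_lim_seq_le_loc (fun _ => sum_n u n) (sum_n u) (sum_n u n) (Series u) _ (is_lim_seq_const _) L).
  exists n. intros m Hm. apply sum_n_le_n; auto.
Qed.

Lemma ex_series_bounded (u : nat -> R) (B : R) :
  (forall k, 0 <= u k) -> (forall N, sum_n u N <= B) -> ex_series u.
Proof.
  intros H HB.
  destruct (ex_finite_lim_seq_incr (sum_n u) B) as [l Hl]; auto.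
  - intros n. rewrite sum_n_S. specialize (H (S n)); lra.
  - exists l. exact Hl.
Qed.

Lemma Series_le_bound (u : nat -> R) (B : R) :
  ex_series u -> (forall N, sum_n u N <= B) -> Series u <= B.
Proof.
  intros Hu HB.
  assert (L : is_lim_seq (sum_n u) (Series u)) by exact (Series_correct u Hu).
  exact (is_lim_seq_le (sum_n u) (fun _ => B) (Series u) B HB L (is_lim_seq_const _)).
Qed.

Lemma ex_series_le_R (u v : nat -> R) :
  (forall n, 0 <= u n <= v n) -> ex_series v -> ex_series u.
Proof.
  intros H Hv. apply (ex_series_le (K := R_AbsRing) (V := R_CompleteNormedModule)) with v; auto.
  intros n. change (Rabs (u n) <= v n). rewrite Rabs_pos_eq; apply H.
Qed.

Lemma exp_ge_1_plus (x : R) : 1 + x <= exp x.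
Proof.
  destruct (Req_dec x 0) as [->|H]; [rewrite exp_0; lra|].
  left. apply exp_ineq1; auto.
Qed.

Lemma ln_le_minus_1 (x : R) : 0 < x -> ln x <= x - 1.
Proof. intros H. generalize (exp_ge_1_plus (ln x)). rewrite exp_ln; lra. Qed.

Lemma Rpower_gt0 (x y : R) : 0 < Rpower x y.
Proof. apply exp_pos. Qed.

Lemma rpow_pos (x y : R) : 0 < x -> rpow x y = Rpower x y.
Proof. intros H. unfold rpow. destruct (Rle_dec x 0); auto; lra. Qed.

Lemma rpow_0 (y : R) : rpow 0 y = 0.
Proof. unfold rpow. destruct (Rle_dec 0 0); auto; lra. Qed.

Lemma rpow_ge0 (x y : R) : 0 <= rpow x y.
Proof. unfold rpow. destruct (Rle_dec x 0); [lra|]. left; apply Rpower_gt0. Qed.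

Lemma rpow_le (x y z : R) : 0 <= z -> x <= y -> rpow x z <= rpow y z.
Proof.
  intros Hz Hxy. destruct (Rle_dec x 0) as [Hx|Hx].
  - unfold rpow at 1. destruct (Rle_dec x 0); [apply rpow_ge0|lra].
  - rewrite !rpow_pos by lra. apply Rle_Rpower_l; lra.
Qed.

Lemma rpow_mult_distr (x y z : R) :
  0 <= x -> 0 <= y -> rpow (x * y) z = rpow x z * rpow y z.
Proof.
  intros [Hx| <-] [Hy| <-].
  - rewrite !rpow_pos; auto using Rmult_lt_0_compat. symmetry; apply Rpower_mult_distr; auto.
  - rewrite Rmult_0_r, rpow_0; ring.
  - rewrite Rmult_0_l, rpow_0; ring.
  - rewrite Rmult_0_l, rpow_0; ring.
Qed.

Lemma rpow_rpow (x y z : R) : 0 <= x -> y * z = 1 -> rpow (rpow x y) z = x.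
Proof.
  intros [Hx| <-] H.
  - rewrite (rpow_pos x) by auto. rewrite rpow_pos by apply Rpower_gt0.
    rewrite Rpower_mult, H, Rpower_1; auto.
  - now rewrite !rpow_0.
Qed.

(* Weighted AM-GM: with [1/p + 1/q = 1], [u = (u^p)^(1/p) 1^(1/q) <= u^p/p + 1/q]. *)
Lemma rpow_Bernoulli (p u : R) : 1 < p -> 0 <= u -> 1 + p * (u - 1) <= rpow u p.
Proof.
  intros Hp [Hu| <-]; [|rewrite rpow_0; lra].
  rewrite rpow_pos by auto.
  set (A := Rpower u p). assert (HA : 0 < A) by apply Rpower_gt0.
  assert (Hiu : 0 < / u) by now apply Rinv_0_lt_compat.
  assert (H1 := ln_le_minus_1 (A * / u) (Rmult_lt_0_compat _ _ HA Hiu)).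
  assert (H2 := ln_le_minus_1 (/ u) Hiu).
  rewrite ln_mult, ln_Rinv in H1 by auto. rewrite ln_Rinv in H2 by auto.
  unfold A at 1 in H1. rewrite ln_Rpower in H1.
  assert (H3 : 0 <= u * (A * / u - 1 - (p * ln u - ln u) + (p - 1) * (/ u - 1 + ln u))) by (apply Rmult_le_pos; nra).
  replace (u * (A * / u - 1 - (p * ln u - ln u) + (p - 1) * (/ u - 1 + ln u)))
    with (A - p * u + (p - 1)) in H3 by (field; lra).
  lra.
Qed.

(** [rpow_Bernoulli] at [x / t], multiplied by [t^p]. *)
Lemma rpow_tangent (p x t : R) : 1 < p -> 0 < t -> 0 <= x ->
  rpow t p + p * (rpow t p / t) * (x - t) <= rpow x p.
Proof.
  intros Hp Ht Hx.
  assert (Hxt : 0 <= x / t) by (apply Rmult_le_pos; auto; left; now apply Rinv_0_lt_compat).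
  replace (rpow x p) with (rpow t p * rpow (x / t) p).
  2:{ rewrite <- rpow_mult_distr by lra. f_equal. field; lra. }
  replace (rpow t p + p * (rpow t p / t) * (x - t)) with (rpow t p * (1 + p * (x / t - 1))) by (field; lra).
  apply Rmult_le_compat_l; [apply rpow_ge0|]. apply rpow_Bernoulli; auto.
Qed.

(** Sum the tangents to [x^p] at [t = s / W], where [s] is the weighted sum. Their constant part
    [t^p - c t = -(p-1) t^p] is nonpositive, so a total mass at most [W] suffices and [W] may be any
    upper bound of partial sums. *)
Lemma rpow_Jensen (p W : R) (w x : nat -> R) (n : nat) :
  1 < p -> 0 < W -> (forall k, 0 <= w k) -> (forall k, 0 <= x k) ->
  sum_n w n <= W ->
  rpow (sum_n (fun k => w k * x k) n) p
  <= Rpower W (p - 1) * sum_n (fun k => w k * rpow (x k) p) n.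
Proof.
  intros Hp HW Hw Hx HwW.
  set (s := sum_n (fun k => w k * x k) n).
  assert (Hs : 0 <= s) by (apply sum_n_ge0; intros; apply Rmult_le_pos; auto).
  destruct Hs as [Hs|Hs].
  (* For [s = 0] the tangent point would be [0], which [rpow_tangent] excludes. *)
  2:{ rewrite <- Hs, rpow_0. apply Rmult_le_pos; [left; apply Rpower_gt0|].
      apply sum_n_ge0; intros; apply Rmult_le_pos; auto using rpow_ge0. }
  set (t := s / W). assert (Ht : 0 < t) by (apply Rdiv_lt_0_compat; auto).
  assert (E : Rpower W (p - 1) * W = rpow W p).
  { rewrite rpow_pos by auto. rewrite <- (Rpower_1 W) at 2 by auto. rewrite <- Rpower_plus. f_equal; ring. }
  replace (rpow s p) with (Rpower W (p - 1) * (W * rpow t p)).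
  2:{ rewrite <- Rmult_assoc, E, <- rpow_mult_distr by lra. f_equal. unfold t; field; lra. }
  apply Rmult_le_compat_l; [left; apply Rpower_gt0|].
  set (c := p * (rpow t p / t)).
  apply Rle_trans with (sum_n (fun k => (rpow t p - c * t) * w k + c * (w k * x k)) n).
  - rewrite sum_n_add, !sum_n_scal. fold s.
    replace s with (W * t) by (unfold t; field; lra).
    replace (c * t) with (p * rpow t p) by (unfold c; field; lra).
    replace (c * (W * t)) with (p * rpow t p * W) by (unfold c; field; lra).
    assert (H := rpow_ge0 t p). assert (0 <= (p - 1) * rpow t p * (W - sum_n w n)).
    { apply Rmult_le_pos; [apply Rmult_le_pos|]; lra. }
    lra.
  - apply sum_n_le; intros k _.
    generalize (rpow_tangent p (x k) t Hp Ht (Hx k)). fold c. intros H.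
    assert (H' := Rmult_le_compat_l (w k) _ _ (Hw k) H). lra.
Qed.

(** * Dirichlet convolution *)

(** Index [n] stands for the integer [n+1]. Summing an indicator over a box, instead of over
    divisors, lets the box be enlarged at will and reduces every rearrangement to [sum_n_switch].
    The ring is a parameter because coefficients in [C] are compared with their moduli in [R]. *)
Definition dconv {K : Ring} (a b : nat -> K) (n : nat) : K :=
  sum_n (fun k => sum_n (fun j =>
    if Nat.eq_dec (S k * S j) (S n) then mult (a k) (b j) else zero) n) n.

Lemma dconv_extend {K : Ring} (a b : nat -> K) (n N : nat) : (n <= N)%nat ->
  dconv a b n = sum_n (fun k => sum_n (fun j =>
    if Nat.eq_dec (S k * S j) (S n) then mult (a k) (b j) else zero) N) N.
Proof.
  intros H. unfold dconv. symmetry. rewrite (sum_n_extend _ n N H).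
  - apply sum_n_ext. intros k. apply sum_n_extend; auto.
    intros j Hj. destruct (Nat.eq_dec (S k * S j) (S n)); auto. exfalso; nia.
  - intros k Hk. apply sum_n_zero. intros j _.
    destruct (Nat.eq_dec (S k * S j) (S n)); auto. exfalso; nia.
Qed.

(** Once all boxes are enlarged to [N], a pair [(k, j)] is met exactly once, at [n+1 = (k+1)(j+1)],
    if this product is at most [N+1]. *)
Lemma sum_n_dconv {K : Ring} (a b : nat -> K) (N : nat) :
  sum_n (dconv a b) N = sum_n (fun k => sum_n (fun j =>
    if le_dec (S k * S j) (S N) then mult (a k) (b j) else zero) N) N.
Proof.
  rewrite (sum_n_ext_loc _ (fun n => sum_n (fun k => sum_n (fun j =>
    if Nat.eq_dec (S k * S j) (S n) then mult (a k) (b j) else zero) N) N))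
    by (intros; apply dconv_extend; auto).
  rewrite sum_n_switch. apply sum_n_ext. intros k. rewrite sum_n_switch.
  apply sum_n_ext. intros j. destruct (le_dec (S k * S j) (S N)) as [H|H].
  - rewrite (sum_n_single _ (pred (S k * S j))).
    + destruct (Nat.eq_dec (S k * S j) (S (Nat.pred (S k * S j)))); auto. exfalso; lia.
    + lia.
    + intros i Hi Hn. destruct (Nat.eq_dec (S k * S j) (S i)); auto. exfalso; lia.
  - apply sum_n_zero. intros i Hi.
    destruct (Nat.eq_dec (S k * S j) (S i)); auto. exfalso; lia.
Qed.

Lemma dconv_ge0 (u v : nat -> R) (n : nat) :
  (forall k, 0 <= u k) -> (forall k, 0 <= v k) -> 0 <= dconv (K := R_Ring) u v n.
Proof.
  intros Hu Hv. apply sum_n_ge0; intros k _. apply sum_n_ge0; intros j _.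
  destruct Nat.eq_dec; [apply Rmult_le_pos; auto|apply Rle_refl].
Qed.

Lemma Cmod_dconv (a b : nat -> C) (n : nat) :
  Cmod (dconv (K := C_Ring) a b n)
  <= dconv (K := R_Ring) (fun k => Cmod (a k)) (fun k => Cmod (b k)) n.
Proof.
  unfold dconv. eapply Rle_trans; [apply Cmod_sum_n|]. apply sum_n_le; intros k _.
  eapply Rle_trans; [apply Cmod_sum_n|]. apply sum_n_le; intros j _.
  destruct Nat.eq_dec.
  - right. apply Cmod_mult.
  - right. apply Cmod_0.
Qed.

Lemma sum_n_const_tail (u : nat -> R) (c : R) (n j : nat) :
  (forall i, (n < i <= n + j)%nat -> u i = c) -> sum_n u (n + j) = sum_n u n + INR j * c.
Proof.
  induction j as [|j IH]; intros H.
  - rewrite Nat.add_0_r. simpl. rewrite Rmult_0_l, Rplus_0_r. reflexivity.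
  - rewrite Nat.add_succ_r, sum_n_S, IH, S_INR.
    + rewrite (H (S (n + j))) by lia.
      rewrite Rmult_plus_distr_r, Rmult_1_l, Rplus_assoc. reflexivity.
    + intros; apply H; lia.
Qed.

Lemma sum_n_div (phi : nat -> R) (K M : nat) :
  sum_n (fun n => phi (n / S K)%nat) (S K * M + K) = INR (S K) * sum_n phi M.
Proof.
  induction M as [|M IH].
  - rewrite Nat.mul_0_r, (sum_n_ext_loc _ (fun _ => phi 0%nat)).
    + rewrite sum_n_const, sum_O. reflexivity.
    + intros n Hn. f_equal. apply Nat.div_small. lia.
  - rewrite sum_n_S, Rmult_plus_distr_l, <- IH.
    replace (S K * S M + K)%nat with (S K * M + K + S K)%nat by lia.
    apply sum_n_const_tail. intros i Hi. f_equal. symmetry.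
    apply (Nat.div_unique i (S K) (S M) (i - S K * S M)); lia.
Qed.

(** As [phi 0 = 0], both sums may start from the argument [0]; then the integers are cut into runs
    of length [K+1] on which the quotient is constant. *)
Lemma sum_n_div_le (phi : nat -> R) (K N : nat) :
  (forall k, 0 <= phi k) -> phi 0%nat = 0 ->
  sum_n (fun n => phi (S n / S K)%nat) N <= INR (S K) * sum_n (fun n => phi (S n)) N.
Proof.
  intros H H0.
  assert (E : forall u : nat -> R, u 0%nat = 0 -> sum_n (fun n => u (S n)) N = sum_n u (S N)).
  { intros u Hu. induction N as [|N' IH].
    - rewrite sum_n_S, !sum_O, Hu. symmetry; apply Rplus_0_l.
    - rewrite sum_n_S, IH, (sum_n_S u (S N')). reflexivity. }
  rewrite (E phi H0), (E (fun n => phi (n / S K)%nat)) by (rewrite Nat.Div0.div_0_l; auto).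
  rewrite <- sum_n_div. apply sum_n_le_n; auto. nia.
Qed.

Lemma ces_term_ge0 (p : R) (a : nat -> C) (n : nat) : 0 <= ces_term p a n.
Proof. apply rpow_ge0. Qed.

Lemma sum_n_Cmod_ge0 (a : nat -> C) (n : nat) : 0 <= sum_n (fun k => Cmod (a k)) n.
Proof. apply sum_n_ge0; intros; apply Cmod_ge_0. Qed.

Lemma INR_S_gt0 (n : nat) : 0 < INR (S n).
Proof. apply lt_0_INR; lia. Qed.

Lemma A_term_ge0 (r : R) (a : nat -> C) (n : nat) : 0 <= A_term r a n.
Proof. apply Rmult_le_pos; [apply Cmod_ge_0|left; apply Rpower_gt0]. Qed.

(** For fixed [k], the condition [(k+1)(j+1) <= n+1] reads [j+1 <= floor((n+1)/(k+1))]. The branch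
    [O] is only a default: the quotient is positive for [k <= n]. *)
Lemma sum_n_Cmod_dconv (a b : nat -> C) (n : nat) :
  sum_n (fun i => Cmod (dconv (K := C_Ring) a b i)) n
  <= sum_n (fun k => Cmod (a k) * match (S n / S k)%nat with
       | O => 0 | S m => sum_n (fun j => Cmod (b j)) m end) n.
Proof.
  eapply Rle_trans; [apply sum_n_le; intros; apply Cmod_dconv|].
  eapply Rle_trans; [right; apply (sum_n_dconv (K := R_Ring))|].
  right. apply sum_n_ext_loc. intros k Hk.
  transitivity (sum_n (fun j => Cmod (a k) * (if le_dec (S k * S j) (S n) then Cmod (b j) else 0)) n).
  { apply sum_n_ext; intros j. destruct le_dec; [reflexivity|]. symmetry. apply Rmult_0_r. }
  rewrite sum_n_scal. f_equal.
  assert (Hq := Nat.div_mod (S n) (S k) ltac:(lia)).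
  assert (Hr := Nat.mod_upper_bound (S n) (S k) ltac:(lia)).
  destruct (S n / S k)%nat as [|m].
  - exfalso. lia.
  - rewrite (sum_n_extend _ m n).
    + apply sum_n_ext_loc. intros j Hj. destruct le_dec; auto. exfalso; nia.
    + nia.
    + intros j Hj. destruct le_dec; auto. exfalso; nia.
Qed.

(* The average at [n] of the dilation of [b] by [k] is at most [1/k] times the
   average of [b] at [floor(n/k)], and each value of [floor(n/k)] is taken [k]
   times: the dilation has norm [k^(1/p - 1) = k^(-1/q)]. *)
Lemma ces_term_dconv (p q W : R) (a b : nat -> C) (n : nat) :
  1 < p -> 1 / p + 1 / q = 1 -> 0 < W -> sum_n (A_term (1 / q) a) n <= W ->
  ces_term p (dconv (K := C_Ring) a b) n
  <= Rpower W (p - 1) * sum_n (fun k => A_term (1 / q) a k * (/ INR (S k) *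
       match (S n / S k)%nat with O => 0 | S m => ces_term p b m end)) n.
Proof.
  intros Hp Hpq HW Ha.
  (* The Jensen weights are [|a_k| (k+1)^(-1/q)], so [x k] carries the compensating factor
     [(k+1)^(1/q)]. *)
  set (x := fun k => Rpower (INR (S k)) (1 / q) * (/ INR (S n) *
     match (S n / S k)%nat with O => 0 | S m => sum_n (fun j => Cmod (b j)) m end)).
  assert (Hx : forall k, 0 <= x k).
  { intros k. apply Rmult_le_pos; [left; apply Rpower_gt0|].
    apply Rmult_le_pos; [left; apply Rinv_0_lt_compat, INR_S_gt0|].
    destruct (S n / S k)%nat; [lra|apply sum_n_Cmod_ge0]. }
  apply Rle_trans with (rpow (sum_n (fun k => A_term (1 / q) a k * x k) n) p).
  - unfold ces_term. apply rpow_le; [lra|].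
    eapply Rle_trans.
    + apply Rmult_le_compat_l; [left; apply Rinv_0_lt_compat, INR_S_gt0|]. apply sum_n_Cmod_dconv.
    + rewrite <- sum_n_scal. right. apply sum_n_ext. intros k. unfold A_term, x.
      set (v := match (S n / S k)%nat with O => 0 | S m => sum_n (fun j => Cmod (b j)) m end).
      rewrite Rpower_Ropp. assert (H := Rpower_gt0 (INR (S k)) (1 / q)).
      assert (H' := INR_S_gt0 n). apply Rminus_diag_uniq; field; lra.
  - eapply Rle_trans; [apply (rpow_Jensen p W); auto using A_term_ge0|].
    apply Rmult_le_compat_l; [left; apply Rpower_gt0|].
    apply sum_n_le; intros k _. apply Rmult_le_compat_l; [apply A_term_ge0|].
    assert (Hq := Nat.div_mod (S n) (S k) ltac:(lia)).
    unfold x. destruct (S n / S k)%nat as [|m].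
    { rewrite !Rmult_0_r, rpow_0. lra. }
    unfold ces_term. set (s := sum_n (fun j => Cmod (b j)) m).
    assert (Hs : 0 <= s) by apply sum_n_Cmod_ge0.
    assert (Hk := INR_S_gt0 k). assert (Hm := INR_S_gt0 m). assert (Hn := INR_S_gt0 n).
    assert (Hik := Rinv_0_lt_compat _ Hk). assert (Him := Rinv_0_lt_compat _ Hm).
    (* Conjugacy enters here: [(1/q - 1) p = -1]. What remains after taking [p]-th roots is
       [(k+1)(m+1) <= n+1]. *)
    replace (/ INR (S k)) with (rpow (Rpower (INR (S k)) (1 / q) * / INR (S k)) p).
    2:{ rewrite rpow_pos by (apply Rmult_lt_0_compat; auto; apply Rpower_gt0).
        rewrite <- (Rpower_1 (INR (S k))) at 2 by auto.
        rewrite <- Rpower_Ropp, <- Rpower_plus, Rpower_mult.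
        replace ((1 / q + - (1)) * p) with (- (1)).
        - rewrite Rpower_Ropp, Rpower_1; auto.
        - replace (1 / q) with (1 - 1 / p) by lra. field; lra. }
    rewrite <- rpow_mult_distr.
    + apply rpow_le; [lra|]. rewrite !Rmult_assoc. apply Rmult_le_compat_l; [left; apply Rpower_gt0|].
      rewrite <- Rmult_assoc. apply Rmult_le_compat_r; auto.
      rewrite <- Rinv_mult. apply Rinv_le_contravar; [nra|].
      rewrite <- mult_INR. apply le_INR. lia.
    + apply Rmult_le_pos; [left; apply Rpower_gt0|lra].
    + apply Rmult_le_pos; lra.
Qed.

(** Summing over [n] first, each [k] gives [1/(k+1)] times a sum in which a term of [b] occurs at
    most [k+1] times. The weights then add up to at most [W], which completes [W^(p-1)] to [W^p]. *)
Lemma sum_n_ces_term_dconv (p q W : R) (a b : nat -> C) (N : nat) :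
  1 < p -> 1 / p + 1 / q = 1 -> 0 < W -> sum_n (A_term (1 / q) a) N <= W ->
  sum_n (ces_term p (dconv (K := C_Ring) a b)) N <= Rpower W p * sum_n (ces_term p b) N.
Proof.
  intros Hp Hpq HW Ha.
  set (phi := fun m => match m with O => 0 | S m' => ces_term p b m' end).
  assert (Hphi : forall m, 0 <= phi m) by (intros [|m]; simpl; [lra|apply ces_term_ge0]).
  apply Rle_trans with (sum_n (fun n => Rpower W (p - 1) * sum_n (fun k =>
    A_term (1 / q) a k * (/ INR (S k) * phi (S n / S k)%nat)) N) N).
  - apply sum_n_le. intros n Hn.
    assert (H0 : forall k, 0 <= A_term (1 / q) a k * (/ INR (S k) * phi (S n / S k)%nat)).
    { intros k. apply Rmult_le_pos; [apply A_term_ge0|]. apply Rmult_le_pos; auto.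
      left; apply Rinv_0_lt_compat, INR_S_gt0. }
    eapply Rle_trans; [apply (ces_term_dconv p q W); auto|].
    + eapply Rle_trans; [|exact Ha]. apply sum_n_le_n; auto using A_term_ge0.
    + apply Rmult_le_compat_l; [left; apply Rpower_gt0|]. apply (sum_n_le_n _ n N H0 Hn).
  - rewrite sum_n_scal, sum_n_switch.
    apply Rle_trans with (Rpower W (p - 1) * (W * sum_n (ces_term p b) N)).
    + apply Rmult_le_compat_l; [left; apply Rpower_gt0|].
      apply Rle_trans with (sum_n (fun k => sum_n (ces_term p b) N * A_term (1 / q) a k) N).
      * apply sum_n_le. intros k _. rewrite sum_n_scal.
        rewrite (Rmult_comm (sum_n _ _)). apply Rmult_le_compat_l; [apply A_term_ge0|].
        rewrite sum_n_scal. assert (H := sum_n_div_le phi k N Hphi eq_refl).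
        assert (Hk := INR_S_gt0 k).
        apply Rmult_le_reg_l with (INR (S k)); auto. rewrite <- Rmult_assoc, Rinv_r, Rmult_1_l by lra.
        exact H.
      * rewrite sum_n_scal, Rmult_comm. apply Rmult_le_compat_r; auto.
        apply sum_n_ge0; intros; apply ces_term_ge0.
    + rewrite <- Rmult_assoc. right. f_equal.
      rewrite <- (Rpower_1 W) at 2 by auto. rewrite <- Rpower_plus. f_equal; ring.
Qed.

(** * Absolute convergence *)

(** Convexity of [y^(-s)]: in the form [x^(-s) - y^(-s) <= s x^(-s-1) (y - x)] it controls the
    differences in telescoping sums and in summation by parts. *)
Lemma Rpower_neg_tangent (x y s : R) : 0 < x -> 0 < y -> 0 <= s ->
  Rpower x (- s) * (1 - s * (y / x - 1)) <= Rpower y (- s).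
Proof.
  intros Hx Hy Hs.
  assert (Hxy : 0 < y / x) by now apply Rdiv_lt_0_compat.
  replace (Rpower y (- s)) with (Rpower x (- s) * exp (- s * ln (y / x))).
  2:{ fold (Rpower (y / x) (- s)). rewrite Rpower_mult_distr by auto. f_equal. field; lra. }
  apply Rmult_le_compat_l; [left; apply Rpower_gt0|].
  eapply Rle_trans; [|apply exp_ge_1_plus].
  assert (H := ln_le_minus_1 _ Hxy). nra.
Qed.

Lemma Rpower_minus_1 (x y : R) : 0 < x -> Rpower x (y - 1) = Rpower x y / x.
Proof.
  intros Hx. unfold Rminus, Rdiv. rewrite Rpower_plus, Rpower_Ropp, Rpower_1; auto.
Qed.

Lemma INR_S_ge1 (n : nat) : 1 <= INR (S n).
Proof. apply (le_INR 1); lia. Qed.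

Lemma ex_series_Rpower (e : R) : 0 < e ->
  ex_series (fun n => Rpower (INR (S n)) (- e - 1)).
Proof.
  intros He. apply (ex_series_bounded _ (1 + / e)).
  { intros; left; apply Rpower_gt0. }
  intros N.
  (* The bound is [1] plus the integral of [x^(-e-1)] over [[1, N+1]]; the induction step uses the
     tangent at the right endpoint. *)
  apply Rle_trans with (1 + / e * (1 - Rpower (INR (S N)) (- e))).
  2:{ assert (H := Rpower_gt0 (INR (S N)) (- e)). assert (H' := Rinv_0_lt_compat e He). nra. }
  induction N as [|N IH].
  - rewrite sum_O. simpl INR. unfold Rpower. rewrite ln_1, !Rmult_0_r, exp_0. lra.
  - rewrite sum_n_S. assert (HN := INR_S_gt0 N). rewrite (S_INR (S N)) in *.
    set (x := INR (S N)) in *.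
    assert (H := Rpower_neg_tangent (x + 1) x e ltac:(lra) HN ltac:(lra)).
    rewrite Rpower_minus_1 by lra.
    replace (x / (x + 1) - 1) with (- / (x + 1)) in H by (field; lra).
    assert (Hi := Rinv_0_lt_compat e He).
    assert (H2 := Rmult_le_compat_l (/ e) _ _ (Rlt_le _ _ Hi) H).
    replace (/ e * (Rpower (x + 1) (- e) * (1 - e * - / (x + 1)))) with
      (/ e * Rpower (x + 1) (- e) + Rpower (x + 1) (- e) / (x + 1)) in H2 by (field; lra).
    lra.
Qed.

Lemma sum_n_lower (u : nat -> R) (c : R) (n j : nat) : (forall i, 0 <= u i) ->
  (forall i, (n < i <= n + j)%nat -> c <= u i) -> INR j * c <= sum_n u (n + j).
Proof.
  intros H0; induction j as [|j IH]; intros H.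
  - simpl. rewrite Rmult_0_l. apply sum_n_ge0; auto.
  - rewrite Nat.add_succ_r, sum_n_S, S_INR.
    assert (H1 := IH ltac:(intros; apply H; lia)). assert (H2 := H (S (n + j)) ltac:(lia)). lra.
Qed.

(* Each average over [n < m <= 2n + 1] is at least half of the one at [n]. *)
Lemma ces_growth (p q M : R) (b : nat -> C) (n : nat) :
  1 < p -> 1 / p + 1 / q = 1 -> 0 < M ->
  (forall N, sum_n (ces_term p b) N <= Rpower M p) ->
  sum_n (fun k => Cmod (b k)) n <= 2 * M * Rpower (INR (S n)) (1 / q).
Proof.
  intros Hp Hpq HM Hb. set (s := sum_n (fun k => Cmod (b k)) n).
  assert (Hs : 0 <= s) by apply sum_n_Cmod_ge0.
  assert (Hn := INR_S_gt0 n). set (y := INR (S n)) in *.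
  assert (Hp' : 0 <= 1 / p) by (apply Rlt_le, Rdiv_lt_0_compat; lra).
  assert (H : y * rpow (s / (2 * y)) p <= Rpower M p).
  { eapply Rle_trans; [|apply (Hb (n + S n)%nat)]. apply sum_n_lower; [apply ces_term_ge0|].
    intros i Hi. apply rpow_le; [lra|]. unfold Rdiv. rewrite Rmult_comm.
    apply Rmult_le_compat; auto.
    - left; apply Rinv_0_lt_compat; lra.
    - apply Rinv_le_contravar; [apply INR_S_gt0|]. unfold y. rewrite <- (mult_INR 2). apply le_INR. lia.
    - apply sum_n_le_n; [intros; apply Cmod_ge_0|lia]. }
  apply rpow_le with (z := 1 / p) in H; auto.
  assert (Hx : 0 <= s / (2 * y)) by (apply Rmult_le_pos; auto; left; apply Rinv_0_lt_compat; lra).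
  rewrite rpow_mult_distr, rpow_rpow, rpow_pos, rpow_pos, Rpower_mult in H; auto using rpow_ge0, Rpower_gt0, Rlt_le; try (field; lra).
  replace (p * (1 / p)) with 1 in H by (field; lra). rewrite Rpower_1 in H by auto.
  replace (1 / q) with (- (1 / p) + 1) by lra.
  rewrite Rpower_plus, Rpower_Ropp, Rpower_1 by auto.
  assert (Hc := Rpower_gt0 y (1 / p)). set (c := Rpower y (1 / p)) in *.
  apply Rmult_le_reg_l with (c / (2 * y)); [apply Rdiv_lt_0_compat; lra|].
  replace (c / (2 * y) * s) with (c * (s / (2 * y))) by (field; lra).
  replace (c / (2 * y) * (2 * M * (/ c * y))) with M by (field; lra). exact H.
Qed.

(** Summation by parts: the boundary term is at most [2 M], and the differences of [(k+1)^(-sg)]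
    against partial sums of order [(k+1)^t] leave the convergent series of [(k+1)^(t-sg-1)]. The
    result is linear in [M], as a bound on point evaluations must be. *)
Lemma Abel_bound (sg t M : R) (b : nat -> C) (N : nat) : 0 < t < sg -> 0 < M ->
  (forall n, sum_n (fun k => Cmod (b k)) n <= 2 * M * Rpower (INR (S n)) t) ->
  sum_n (A_term sg b) N
  <= (2 + 2 * sg * Series (fun n => Rpower (INR (S n)) (- (sg - t) - 1))) * M.
Proof.
  intros Ht HM Hb. set (u := fun n => Rpower (INR (S n)) (- (sg - t) - 1)).
  (* [sum_n u N - u N] is the sum over indices below [N], one for each difference of consecutive
     powers. *)
  assert (H : sum_n (A_term sg b) N <=
    sum_n (fun k => Cmod (b k)) N * Rpower (INR (S N)) (- sg) + 2 * M * sg * (sum_n u N - u N)).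
  { induction N as [|N IH].
    - rewrite !sum_O. unfold A_term. lra.
    - rewrite !sum_n_S. unfold A_term at 2. assert (HN := INR_S_gt0 N).
      assert (D := Rpower_neg_tangent (INR (S N)) (INR (S (S N))) sg HN (INR_S_gt0 _) ltac:(lra)).
      replace (INR (S (S N)) / INR (S N) - 1) with (/ INR (S N)) in D by (rewrite (S_INR (S N)); field; lra).
      set (s := sum_n (fun k => Cmod (b k)) N) in *.
      assert (Hs : 0 <= s) by apply sum_n_Cmod_ge0.
      assert (D2 := Rmult_le_compat_l _ _ _ Hs D).
      assert (G : s * (sg * Rpower (INR (S N)) (- sg) * / INR (S N)) <= 2 * M * sg * u N).
      { unfold u. replace (- (sg - t) - 1) with (t + (- sg - 1)) by ring.
        rewrite Rpower_plus, Rpower_minus_1 by auto.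
        assert (Hc := Rpower_gt0 (INR (S N)) (- sg)).
        assert (Hi := Rinv_0_lt_compat _ HN).
        assert (0 <= sg * Rpower (INR (S N)) (- sg) * / INR (S N)).
        { repeat apply Rmult_le_pos; lra. }
        eapply Rle_trans; [apply Rmult_le_compat_r; [auto|apply (Hb N)]|]. right; unfold Rdiv; ring. }
      lra. }
  eapply Rle_trans; [exact H|].
  assert (H1 : sum_n (fun k => Cmod (b k)) N * Rpower (INR (S N)) (- sg) <= 2 * M).
  { eapply Rle_trans; [apply Rmult_le_compat_r; [left; apply Rpower_gt0|apply Hb]|].
    rewrite Rmult_assoc, <- Rpower_plus.
    assert (Rpower (INR (S N)) (t + - sg) <= 1).
    { rewrite <- (Rpower_O (INR (S N))) by apply INR_S_gt0.
      apply Rle_Rpower; [apply INR_S_ge1|lra]. }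
    nra. }
  assert (H2 : sum_n u N <= Series u).
  { apply sum_n_Series_le; [intros; left; apply Rpower_gt0|]. apply ex_series_Rpower; lra. }
  assert (0 <= u N) by (left; apply Rpower_gt0).
  assert (2 * M * sg * (sum_n u N - u N) <= 2 * M * sg * Series u).
  { apply Rmult_le_compat_l; [repeat apply Rmult_le_pos|]; lra. }
  lra.
Qed.

(** * Products of Dirichlet series *)

Lemma Cexp_plus (z w : C) : Cexp (z + w) = (Cexp z * Cexp w)%C.
Proof.
  unfold Cexp, Cplus, Cmult, Re, Im; simpl.
  rewrite exp_plus, cos_plus, sin_plus. f_equal; ring.
Qed.

Lemma Cmod_Cexp (z : C) : Cmod (Cexp z) = exp (Re z).
Proof.
  unfold Cmod, Cexp; simpl fst; simpl snd.
  replace ((exp (Re z) * cos (Im z)) ^ 2 + (exp (Re z) * sin (Im z)) ^ 2) with (Rsqr (exp (Re z))).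
  - apply sqrt_Rsqr. left; apply exp_pos.
  - assert (H := sin2_cos2 (Im z)). unfold Rsqr in *.
    transitivity (exp (Re z) * exp (Re z) * 1); [ring|]. rewrite <- H. ring.
Qed.

Lemma dpow_plus (n : nat) (s h : C) : dpow n (s + h) = (dpow n s * dpow n h)%C.
Proof. unfold dpow. rewrite <- Cexp_plus. f_equal. ring. Qed.

Lemma dpow_mult (k j n : nat) (s : C) : (S k * S j = S n)%nat ->
  (dpow k s * dpow j s)%C = dpow n s.
Proof.
  intros H. unfold dpow. rewrite <- Cexp_plus, <- H, mult_INR, ln_mult by apply INR_S_gt0.
  f_equal. rewrite RtoC_plus. ring.
Qed.

Lemma Cmod_dpow (n : nat) (s : C) : Cmod (dpow n s) = Rpower (INR (S n)) (- Re s).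
Proof.
  unfold dpow, Rpower. rewrite Cmod_Cexp. f_equal.
  generalize (ln (INR (S n))). intros L. unfold Cmult, Copp, RtoC, Re; simpl. ring.
Qed.

Lemma dpow_0 (s : C) : dpow 0 s = RtoC 1.
Proof.
  unfold dpow. simpl INR. rewrite ln_1. replace (- s * RtoC 0)%C with (RtoC 0) by ring.
  unfold Cexp, Re, Im, RtoC; simpl. rewrite exp_0, cos_0, sin_0. f_equal; ring.
Qed.

Lemma Cmod_dterm (a : nat -> C) (n : nat) (s : C) :
  Cmod (a n * dpow n s)%C = A_term (Re s) a n.
Proof. unfold A_term. now rewrite Cmod_mult, Cmod_dpow. Qed.

Lemma A_term_anti (r r' : R) (a : nat -> C) (n : nat) : r <= r' -> A_term r' a n <= A_term r a n.
Proof.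
  intros H. apply Rmult_le_compat_l; [apply Cmod_ge_0|].
  apply Rle_Rpower; [apply INR_S_ge1|lra].
Qed.

Lemma ex_series_A_term_anti (r r' : R) (a : nat -> C) : r <= r' ->
  ex_series (A_term r a) -> ex_series (A_term r' a).
Proof.
  intros H. apply ex_series_le_R. intros n. split; [apply A_term_ge0|now apply A_term_anti].
Qed.

Lemma is_series_C (u : nat -> C) (l : C) :
  is_series (K := C_AbsRing) (V := C_NormedModule) u l <->
  is_lim_seq (fun N => Cmod (sum_n u N - l)%C) 0.
Proof.
  rewrite <- is_lim_seq_spec.
  etransitivity; [apply (filterlim_locally_ball_norm (K := C_AbsRing) (U := C_NormedModule))|].
  unfold ball_norm, is_lim_seq'.
  assert (E : forall (N : nat) (e : posreal),
    norm (minus (sum_n u N) l) < e <-> Rabs (Cmod (sum_n u N - l)%C - 0) < e).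
  { intros N e. rewrite Rminus_0_r, Rabs_pos_eq by apply Cmod_ge_0. reflexivity. }
  split; intros H e; generalize (H e); apply filter_imp; intros N; apply E.
Qed.

Lemma is_series_C_unique (u : nat -> C) (l l' : C) :
  is_series (K := C_AbsRing) (V := C_NormedModule) u l ->
  is_series (K := C_AbsRing) (V := C_NormedModule) u l' -> l = l'.
Proof. intros H H'. exact (filterlim_locally_unique _ _ _ H H'). Qed.

(** A bound along a cofinal set of partial sums is enough; for the lacunary series built from
    blocks, only the sums that end with a block are controlled. *)
Lemma is_series_C_Cmod_le (u : nat -> C) (l : C) (B : R) :
  is_series (K := C_AbsRing) (V := C_NormedModule) u l ->
  (forall N, exists M, (N <= M)%nat /\ Cmod (sum_n u M) <= B) -> Cmod l <= B.
Proof.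
  intros H HB. apply is_series_C in H. apply Rnot_lt_le. intros Hlt.
  apply is_lim_seq_spec in H. destruct (H (mkposreal (Cmod l - B) ltac:(lra))) as [N HN].
  destruct (HB N) as [M [HM HMB]]. specialize (HN M HM). simpl in HN.
  rewrite Rminus_0_r, Rabs_pos_eq in HN by apply Cmod_ge_0.
  assert (T := Cmod_triangle (sum_n u M) (- (sum_n u M - l))%C).
  rewrite Cmod_opp in T. replace (sum_n u M + - (sum_n u M - l))%C with l in T by ring. lra.
Qed.

Lemma ex_series_C (u : nat -> C) : ex_series (fun n => Cmod (u n)) ->
  ex_series (K := C_AbsRing) (V := C_NormedModule) u.
Proof.
  intros H. apply (ex_series_le (K := C_AbsRing) (V := C_CompleteNormedModule)) with (fun n => Cmod (u n)); auto.
  intros n. apply Rle_refl.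
Qed.

Lemma sum_n_dconv_le (u v : nat -> R) (N : nat) :
  (forall k, 0 <= u k) -> (forall k, 0 <= v k) ->
  sum_n (dconv (K := R_Ring) u v) N <= sum_n u N * sum_n v N.
Proof.
  intros Hu Hv. eapply Rle_trans; [right; apply (sum_n_dconv (K := R_Ring))|].
  rewrite Rmult_comm, <- sum_n_scal. apply sum_n_le; intros k _.
  rewrite Rmult_comm, <- sum_n_scal. apply sum_n_le; intros j _.
  destruct le_dec; [apply Rle_refl|]. apply Rmult_le_pos; auto.
Qed.

Lemma sum_n_dconv_ge (u v : nat -> R) (N M : nat) :
  (forall k, 0 <= u k) -> (forall k, 0 <= v k) -> (S N * S N <= S M)%nat ->
  sum_n u N * sum_n v N <= sum_n (dconv (K := R_Ring) u v) M.
Proof.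
  intros Hu Hv HNM. eapply Rle_trans; [|right; symmetry; apply (sum_n_dconv (K := R_Ring))].
  rewrite Rmult_comm, <- sum_n_scal.
  assert (H0 : forall k j, 0 <= (if le_dec (S k * S j) (S M) then u k * v j else 0)).
  { intros k j. destruct le_dec; [apply Rmult_le_pos; auto|lra]. }
  eapply Rle_trans; [|refine (sum_n_le_n _ N M _ _); [intros k; apply sum_n_ge0; intros j _; exact (H0 k j)|nia]].
  apply sum_n_le; intros k Hk. rewrite Rmult_comm, <- sum_n_scal.
  eapply Rle_trans; [|refine (sum_n_le_n _ N M _ _); [intros j; exact (H0 k j)|nia]].
  apply sum_n_le; intros j Hj. destruct le_dec; [apply Rle_refl|]. exfalso; nia.
Qed.

(** The region [(k+1)(j+1) <= M+1] lies in the square of side [M+1] and contains that of side [N+1]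
    when [(N+1)^2 <= M+1], so partial sums of the convolution are squeezed between products of
    partial sums. *)
Lemma is_series_dconv_ge0 (u v : nat -> R) :
  (forall k, 0 <= u k) -> (forall k, 0 <= v k) -> ex_series u -> ex_series v ->
  is_series (dconv (K := R_Ring) u v) (Series u * Series v).
Proof.
  intros Hu Hv Eu Ev.
  assert (H0 : forall n, 0 <= dconv (K := R_Ring) u v n) by (intros; apply dconv_ge0; auto).
  assert (HB : forall N, sum_n (dconv (K := R_Ring) u v) N <= Series u * Series v).
  { intros N. eapply Rle_trans; [apply sum_n_dconv_le; auto|].
    apply Rmult_le_compat; try apply sum_n_ge0; auto; apply sum_n_Series_le; auto. }
  assert (E : ex_series (dconv (K := R_Ring) u v)) by (eapply ex_series_bounded; eauto).
  replace (Series u * Series v) with (Series (dconv (K := R_Ring) u v)); [now apply Series_correct|].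
  apply Rle_antisym; [now apply Series_le_bound|].
  assert (L : is_lim_seq (fun N => sum_n u N * sum_n v N) (Series u * Series v)).
  { apply is_lim_seq_mult'; [exact (Series_correct u Eu)|exact (Series_correct v Ev)]. }
  refine (is_lim_seq_le _ (fun _ => Series (dconv (K := R_Ring) u v)) _ (Finite _) _ L (is_lim_seq_const _)).
  intros N. eapply Rle_trans; [apply (sum_n_dconv_ge u v N (S N * S N)%nat); auto|].
  apply sum_n_Series_le; auto.
Qed.

(** The product of two partial sums minus the partial sum of the convolution runs over pairs beyond
    the hyperbola. Its modulus is at most the same difference formed with [|u|] and [|v|], which
    tends to [0] by the nonnegative case. *)
Lemma is_series_dconv (u v : nat -> C) (lu lv : C) :
  is_series (K := C_AbsRing) (V := C_NormedModule) u lu ->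
  is_series (K := C_AbsRing) (V := C_NormedModule) v lv ->
  ex_series (fun n => Cmod (u n)) -> ex_series (fun n => Cmod (v n)) ->
  is_series (K := C_AbsRing) (V := C_NormedModule) (dconv (K := C_Ring) u v) (lu * lv)%C.
Proof.
  intros Hu Hv Eu Ev.
  set (u' := fun n => Cmod (u n)) in *. set (v' := fun n => Cmod (v n)) in *.
  assert (Du := proj1 (is_series_C _ _) Hu). assert (Dv := proj1 (is_series_C _ _) Hv).
  apply is_series_C.
  assert (B : forall N, Cmod (sum_n u N * sum_n v N - sum_n (dconv (K := C_Ring) u v) N)%C
     <= sum_n u' N * sum_n v' N - sum_n (dconv (K := R_Ring) u' v') N).
  { intros N.
    assert (E1 : (sum_n u N * sum_n v N)%C = sum_n (fun k => sum_n (fun j => (u k * v j)%C) N) N).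
    { etransitivity; [symmetry; apply (sum_n_mult_r (K := C_Ring) (sum_n v N) u N)|].
      apply sum_n_ext; intros k. symmetry. apply (sum_n_mult_l (K := C_Ring)). }
    assert (E2 : sum_n u' N * sum_n v' N = sum_n (fun k => sum_n (fun j => u' k * v' j) N) N).
    { etransitivity; [symmetry; apply (sum_n_mult_r (K := R_Ring) (sum_n v' N) u' N)|].
      apply sum_n_ext; intros k. symmetry. apply (sum_n_mult_l (K := R_Ring)). }
    rewrite E1, E2.
    rewrite (sum_n_dconv (K := C_Ring) u v N).
    rewrite (sum_n_dconv (K := R_Ring) u' v' N).
    assert (M : forall (G : AbelianGroup) (f g : nat -> nat -> G),
      sum_n (fun k => sum_n (fun j => minus (f k j) (g k j)) N) N =
      minus (sum_n (fun k => sum_n (f k) N) N) (sum_n (fun k => sum_n (g k) N) N)).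
    { intros G f g.
      assert (M1 : forall f g : nat -> G, sum_n (fun j => minus (f j) (g j)) N = minus (sum_n f N) (sum_n g N)).
      { clear. intros f g. induction N as [|N IH]; [now rewrite !sum_O|].
        rewrite !sum_Sn, IH. unfold minus. rewrite opp_plus, !plus_assoc. f_equal.
        rewrite <- !plus_assoc. f_equal. apply plus_comm. }
      rewrite <- M1. apply sum_n_ext; intros k. apply M1. }
    rewrite <- (M C_AbelianGroup). rewrite <- (M R_AbelianGroup).
    eapply Rle_trans; [apply Cmod_sum_n|]. apply sum_n_le; intros k _.
    eapply Rle_trans; [apply Cmod_sum_n|]. apply sum_n_le; intros j _.
    destruct le_dec.
    - right. transitivity 0; [|symmetry; apply Rplus_opp_r].
      etransitivity; [apply f_equal, (minus_eq_zero (G := C_AbelianGroup))|apply Cmod_0].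
    - right. etransitivity; [apply f_equal, (minus_zero_r (G := C_AbelianGroup))|].
      etransitivity; [apply Cmod_mult|]. symmetry. apply (minus_zero_r (G := R_AbelianGroup)). }
  assert (L : is_lim_seq (fun N => sum_n u' N * sum_n v' N - sum_n (dconv (K := R_Ring) u' v') N) 0).
  { replace 0 with (Series u' * Series v' - Series u' * Series v') by ring.
    apply is_lim_seq_minus'.
    - apply is_lim_seq_mult'; [exact (Series_correct u' Eu)|exact (Series_correct v' Ev)].
    - apply is_series_dconv_ge0; auto; intros; apply Cmod_ge_0. }
  apply is_lim_seq_le_le with (u := fun _ => 0)
    (w := fun N => (sum_n u' N * sum_n v' N - sum_n (dconv (K := R_Ring) u' v') N) +
       (Cmod (sum_n u N - lu)%C * Series v' + Cmod lu * Cmod (sum_n v N - lv)%C)).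
  - intros N. split; [apply Cmod_ge_0|].
    specialize (B N).
    set (U := sum_n u N) in *. set (V := sum_n v N) in *. set (D := sum_n (dconv (K := C_Ring) u v) N) in *.
    change (Cmod (D - lu * lv)%C <= sum_n u' N * sum_n v' N - sum_n (dconv (K := R_Ring) u' v') N +
       (Cmod (U - lu)%C * Series v' + Cmod lu * Cmod (V - lv)%C)).
    assert (E : (D - lu * lv)%C = (- (U * V - D) + ((U - lu) * V + lu * (V - lv)))%C).
    { clearbody U V D. clear - U V D lu lv. change C in U, V, D.  match goal with |- ?x = ?y => change (@eq C x y) end. ring. }
    rewrite E. eapply Rle_trans; [apply Cmod_triangle|]. rewrite Cmod_opp.
    apply Rplus_le_compat; [exact B|].
    eapply Rle_trans; [apply Cmod_triangle|]. rewrite !Cmod_mult.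
    apply Rplus_le_compat_r, Rmult_le_compat_l; [apply Cmod_ge_0|].
    eapply Rle_trans; [apply Cmod_sum_n|]. apply sum_n_Series_le; auto; intros; apply Cmod_ge_0.
  - apply is_lim_seq_const.
  - replace 0 with (0 + (0 * Series v' + Cmod lu * 0)) by ring.
    apply is_lim_seq_plus'; [exact L|]. apply is_lim_seq_plus'.
    + apply is_lim_seq_mult'; [exact Du|apply is_lim_seq_const].
    + apply is_lim_seq_mult'; [apply is_lim_seq_const|exact Dv].
Qed.

(** * Uniqueness of coefficients *)

Definition abs_conv (theta : R) (a : nat -> C) : Prop :=
  forall sg, theta < sg -> ex_series (A_term sg a).

Lemma ex_series_Cmod_dterm (theta : R) (a : nat -> C) (s : C) :
  abs_conv theta a -> half_plane theta s -> ex_series (fun n => Cmod (a n * dpow n s)%C).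
Proof.
  intros Ha Hs. apply ex_series_ext with (A_term (Re s) a).
  - intros n. symmetry. apply Cmod_dterm.
  - now apply Ha.
Qed.

Lemma dconv_dpow (a b : nat -> C) (s : C) (n : nat) :
  dconv (K := C_Ring) (fun k => (a k * dpow k s)%C) (fun k => (b k * dpow k s)%C) n
  = (dconv (K := C_Ring) a b n * dpow n s)%C.
Proof.
  unfold dconv. etransitivity; [|apply (sum_n_mult_r (K := C_Ring))].
  apply sum_n_ext; intros k. etransitivity; [|apply (sum_n_mult_r (K := C_Ring))].
  apply sum_n_ext; intros j. destruct Nat.eq_dec as [H|H].
  - rewrite <- (dpow_mult k j n s H). change mult with Cmult.
    match goal with |- ?x = ?y => change (@eq C x y) end. ring.
  - symmetry. apply (mult_zero_l (K := C_Ring)).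
Qed.

Lemma represents_dconv (theta : R) (a b : nat -> C) (f g : C -> C) :
  abs_conv theta a -> abs_conv theta b -> represents theta a f -> represents theta b g ->
  represents theta (dconv (K := C_Ring) a b) (Cfun_mult f g).
Proof.
  intros Ha Hb Hf Hg s Hs.
  apply is_series_ext with (dconv (K := C_Ring) (fun k => (a k * dpow k s)%C) (fun k => (b k * dpow k s)%C)).
  - intros n. apply dconv_dpow.
  - apply is_series_dconv; auto; eapply ex_series_Cmod_dterm; eauto.
Qed.

(** The first nonzero term would dominate all later ones as [s] tends to infinity along the reals;
    hence strong induction on [n]. *)
Lemma represents_0_coef (theta : R) (c : nat -> C) :
  represents theta c (fun _ => RtoC 0) -> forall n, c n = RtoC 0.
Proof.
  intros Hc.
  (* Convergence at [theta + 1] may be conditional. It bounds the terms, eventually by [2], as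
     differences of partial sums of modulus below [1]; two units further right the series converges
     absolutely. *)
  assert (HB : exists B, forall n, A_term (theta + 1) c n <= B).
  { assert (Hs : half_plane theta (RtoC (theta + 1))) by (unfold half_plane; simpl; lra).
    specialize (Hc _ Hs). apply is_series_C in Hc.
    apply is_lim_seq_spec in Hc. destruct (Hc (mkposreal 1 Rlt_0_1)) as [N HN].
    exists (sum_n (A_term (theta + 1) c) N + 2). intros n.
    destruct (le_lt_dec n N) as [H|H].
    - assert (A_term (theta + 1) c n <= sum_n (A_term (theta + 1) c) N)
        by (apply sum_n_term_le; auto using A_term_ge0). lra.
    - assert (H1 := HN n ltac:(lia)). assert (H2 := HN (pred n) ltac:(lia)).
      rewrite Rminus_0_r, Rabs_pos_eq in H1, H2 by apply Cmod_ge_0. simpl in H1, H2.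
      assert (H0 : 0 <= sum_n (A_term (theta + 1) c) N) by (apply sum_n_ge0; auto using A_term_ge0).
      replace (A_term (theta + 1) c n) with (Cmod (c n * dpow n (RtoC (theta + 1)))%C)
        by apply Cmod_dterm.
      destruct n as [|n]; [lia|]. rewrite sum_Sn in H1. simpl pred in H2.
      set (x := sum_n _ n) in *. set (y := (c (S n) * dpow (S n) (RtoC (theta + 1)))%C) in *.
      change (Cmod (x + y - 0)%C < 1) in H1. change (Cmod (x - 0)%C < 1) in H2.
      assert (T := Cmod_triangle (x + y - 0)%C (- (x - 0))%C). rewrite Cmod_opp in T.
      replace (x + y - 0 + - (x - 0))%C with y in T; [lra|].
      clearbody x y. clear. change C in x, y. match goal with |- ?x = ?y => change (@eq C x y) end. ring. }
  destruct HB as [B HB].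
  assert (HS : ex_series (A_term (theta + 3) c)).
  { apply ex_series_le_R with (fun n => B * Rpower (INR (S n)) (- (1) - 1)).
    - intros n. split; [apply A_term_ge0|].
      replace (A_term (theta + 3) c n) with (A_term (theta + 1) c n * Rpower (INR (S n)) (- (1) - 1)).
      + apply Rmult_le_compat_r; auto. left; apply Rpower_gt0.
      + unfold A_term. rewrite Rmult_assoc, <- Rpower_plus. do 2 f_equal. ring.
    - apply (ex_series_scal (K := R_AbsRing) (V := R_NormedModule) B). apply ex_series_Rpower. lra. }
  set (S1 := Series (A_term (theta + 3) c)).
  intros n. induction n as [n IH] using lt_wf_ind.
  assert (Hx := INR_S_gt0 n). assert (Hy := INR_S_gt0 (S n)).
  assert (Hxy : INR (S n) < INR (S (S n))) by (rewrite (S_INR (S n)); lra).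
  set (x := INR (S n)) in *. set (y := INR (S (S n))) in *.
  (* At [theta + 3 + m] the terms before [n] vanish by induction and those after [n] are at most
     [y^(-m)] times their size at [theta + 3]. As the total is [0], the later terms together must
     balance the [n]-th. *)
  assert (Ht : forall m, A_term (theta + 3) c n <= S1 * (x / y) ^ m).
  { intros m. set (s := RtoC (theta + 3 + INR m)).
    assert (Hs : half_plane theta s) by (unfold half_plane; simpl; generalize (pos_INR m); lra).
    specialize (Hc s Hs). apply is_series_C in Hc.
    set (w := fun k => (c k * dpow k s)%C) in *.
    assert (Hw : Cmod (w n) <= Rpower y (- INR m) * S1).
    { refine (is_lim_seq_le_loc (fun _ => Cmod (w n)) (fun N => Cmod (sum_n w N - 0)%C + Rpower y (- INR m) * S1)
        (Cmod (w n)) (Rpower y (- INR m) * S1) _ (is_lim_seq_const _) _).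
      2:{ generalize (is_lim_seq_plus' _ _ _ _ Hc (is_lim_seq_const (Rpower y (- INR m) * S1))).
          rewrite Rplus_0_l. auto. }
      exists n. intros N HN.
      set (u := fun k => if Nat.eq_dec k n then RtoC 0 else w k).
      assert (E : sum_n w N = (sum_n u N + w n)%C).
      { transitivity (sum_n (fun k => plus (u k) (if Nat.eq_dec k n then w n else RtoC 0)) N).
        - apply sum_n_ext; intros k. unfold u. change plus with Cplus.
          match goal with |- ?x = ?y => change (@eq C x y) end.
          destruct Nat.eq_dec as [->|]; ring.
        - rewrite sum_n_plus, (sum_n_single (fun k => if Nat.eq_dec k n then w n else RtoC 0) n N HN).
          + destruct Nat.eq_dec; [reflexivity|lia].
          + intros k _ Hk. destruct Nat.eq_dec; [lia|reflexivity]. }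
      rewrite E. set (U := sum_n u N).
      assert (HU : Cmod U <= Rpower y (- INR m) * S1).
      { eapply Rle_trans; [apply Cmod_sum_n|].
        apply Rle_trans with (sum_n (fun k => Rpower y (- INR m) * A_term (theta + 3) c k) N).
        - apply sum_n_le. intros k _. unfold u.
          assert (P : 0 <= Rpower y (- INR m) * A_term (theta + 3) c k).
          { apply Rmult_le_pos; [left; apply Rpower_gt0|apply A_term_ge0]. }
          destruct Nat.eq_dec as [Hk|Hk]; [now rewrite Cmod_0|].
          destruct (le_lt_dec k n) as [Hkn|Hkn].
          + unfold w. rewrite IH by lia. rewrite Cmult_0_l, Cmod_0; auto.
          + unfold w. rewrite Cmod_dterm. unfold A_term.
            replace (- Re s) with (- (theta + 3) + - INR m) by (unfold s; simpl; ring).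
            rewrite Rpower_plus, <- Rmult_assoc, Rmult_comm.
            apply Rmult_le_compat_r; [apply Rmult_le_pos; [apply Cmod_ge_0|left; apply Rpower_gt0]|].
            rewrite !Rpower_Ropp. apply Rinv_le_contravar; [apply Rpower_gt0|].
            apply Rle_Rpower_l; [apply pos_INR|]. split; auto. apply le_INR. lia.
        - rewrite sum_n_scal. apply Rmult_le_compat_l; [left; apply Rpower_gt0|].
          apply sum_n_Series_le; auto using A_term_ge0. }
      assert (T := Cmod_triangle (U + w n - 0)%C (- U)%C). rewrite Cmod_opp in T.
      replace (U + w n - 0 + - U)%C with (w n) in T; [lra|].
      clearbody U. clear. change C in U. match goal with |- ?x = ?y => change (@eq C x y) end. ring. }
    unfold w in Hw. rewrite Cmod_dterm in Hw. unfold A_term in *.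
    replace (- Re s) with (- (theta + 3) + - INR m) in Hw by (unfold s; simpl; ring).
    fold x in Hw. rewrite Rpower_plus, !Rpower_Ropp, !Rpower_pow in Hw by auto.
    rewrite !Rpower_Ropp in *. fold x.
    unfold Rdiv. rewrite Rpow_mult_distr, pow_inv.
    assert (Px : 0 < x ^ m) by now apply pow_lt. assert (Py : 0 < y ^ m) by now apply pow_lt.
    apply Rmult_le_compat_r with (r := x ^ m) in Hw; [|lra].
    eapply Rle_trans; [|eapply Rle_trans; [exact Hw|]]; right; field; repeat split; try lra.
    generalize (Rpower_gt0 x (theta + 3)); lra. }
  assert (Hr : Rabs (x / y) < 1).
  { rewrite Rabs_pos_eq by (apply Rlt_le, Rdiv_lt_0_compat; auto).
    apply Rmult_lt_reg_r with y; auto. unfold Rdiv. rewrite Rmult_assoc, Rinv_l; lra. }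
  assert (H0 : A_term (theta + 3) c n <= 0).
  { refine (is_lim_seq_le (fun _ => A_term (theta + 3) c n) _ (A_term (theta + 3) c n) 0 Ht (is_lim_seq_const _) _).
    replace 0 with (S1 * 0) by ring. apply is_lim_seq_mult'; [apply is_lim_seq_const|].
    now apply is_lim_seq_geom. }
  apply Cmod_eq_0. unfold A_term in H0. assert (P := Rpower_gt0 (INR (S n)) (- (theta + 3))).
  assert (Q := Cmod_ge_0 (c n)). nra.
Qed.

Lemma represents_unique (theta : R) (a b : nat -> C) (f : C -> C) :
  represents theta a f -> represents theta b f -> a = b.
Proof.
  intros Ha Hb. apply functional_extensionality; intros n.
  assert (H : (a n - b n)%C = RtoC 0).
  { apply (represents_0_coef theta (fun n => (a n - b n)%C)). intros s Hs.
    assert (H := is_series_minus (K := C_AbsRing) (V := C_NormedModule) _ _ _ _ (Ha s Hs) (Hb s Hs)).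
    replace (RtoC 0) with (f s - f s)%C by ring.
    revert H. apply is_series_ext. intros k. change plus with Cplus. change opp with Copp.
    match goal with |- ?x = ?y => change (@eq C x y) end. ring. }
  replace (a n) with (a n - b n + b n)%C by ring. rewrite H. ring.
Qed.

(** Replaces the coefficients picked by [epsilon] by a known sequence; computations of [Hces_norm]
    and [A_norm] start here. *)
Lemma dcoef_represents (theta : R) (a : nat -> C) (f : C -> C) :
  represents theta a f -> dcoef theta f = a.
Proof.
  intros H. apply (represents_unique theta) with f; auto.
  unfold dcoef. apply epsilon_spec. now exists a.
Qed.

(** * Analyticity *)

Lemma exp_Rabs_le (x : R) : exp x <= exp (Rabs x).
Proof. destruct (Rle_abs x) as [H|H]; [left; now apply exp_increasing|right; now f_equal]. Qed.

Lemma Rabs_exp_minus_1 (x : R) : Rabs (exp x - 1) <= Rabs x * exp (Rabs x).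
Proof.
  assert (H1 := exp_ge_1_plus x). assert (H2 := exp_ge_1_plus (- x)).
  assert (H3 := exp_pos x). assert (H4 : exp x * exp (- x) = 1) by (rewrite <- exp_plus, Rplus_opp_r; apply exp_0).
  assert (H5 := exp_ge_1_plus (Rabs x)).
  destruct (Rle_dec 0 x) as [H|H].
  - rewrite (Rabs_pos_eq x) in * by auto. rewrite Rabs_pos_eq by lra. nra.
  - rewrite (Rabs_left x) in * by lra.
    assert (exp x <= 1) by nra. rewrite Rabs_left1 by lra. nra.
Qed.

(** Multiplying [1 - x <= exp (-x)] by [exp x] gives [exp x - 1 - x <= x (exp x - 1)], and
    [Rabs_exp_minus_1] applies. *)
Lemma Rabs_exp_minus_1_minus (x : R) : Rabs (exp x - 1 - x) <= x ^ 2 * exp (Rabs x).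
Proof.
  assert (H1 := exp_ge_1_plus x). assert (H2 := exp_ge_1_plus (- x)).
  assert (H3 := exp_pos x). assert (H4 : exp x * exp (- x) = 1) by (rewrite <- exp_plus, Rplus_opp_r; apply exp_0).
  rewrite Rabs_pos_eq by lra.
  assert (H5 := Rabs_exp_minus_1 x).
  assert (H6 : exp x - 1 - x <= x * (exp x - 1)) by nra.
  eapply Rle_trans; [exact H6|]. eapply Rle_trans; [apply Rle_abs|].
  rewrite Rabs_mult. replace (x ^ 2) with (Rabs x * Rabs x).
  - rewrite Rmult_assoc. apply Rmult_le_compat_l; auto. apply Rabs_pos.
  - rewrite <- Rabs_mult. rewrite Rabs_pos_eq; [ring|nra].
Qed.

Lemma Rabs_sin_le (x : R) : Rabs (sin x) <= Rabs x.
Proof.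
  assert (P : forall y, 0 < y -> Rabs (sin y) <= y).
  { intros y Hy. destruct (Rle_dec y 1) as [H|H].
    - assert (0 <= sin y). { apply sin_ge_0; [lra|]. generalize PI2_1; lra. }
      rewrite Rabs_pos_eq by auto. left; now apply sin_lt_x.
    - apply Rabs_le. generalize (SIN_bound y); lra. }
  destruct (Rtotal_order x 0) as [H|[->|H]].
  - rewrite (Rabs_left x) by auto. rewrite <- Rabs_Ropp, <- sin_neg. apply P; lra.
  - rewrite sin_0; lra.
  - rewrite (Rabs_pos_eq x) by lra. now apply P.
Qed.

Lemma Rabs_cos_minus_1 (x : R) : Rabs (cos x - 1) <= x ^ 2 /\ Rabs (cos x - 1) <= Rabs x.
Proof.
  replace x with (2 * (x / 2)) at 1 3 by field. rewrite cos_2a_sin.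
  assert (H := Rabs_sin_le (x / 2)). assert (H0 := Rabs_pos (sin (x / 2))).
  replace (1 - 2 * sin (x / 2) * sin (x / 2) - 1) with (- (2 * (sin (x / 2) * sin (x / 2)))) by ring.
  rewrite Rabs_Ropp, Rabs_mult, Rabs_mult, (Rabs_pos_eq 2) by lra.
  assert (H1 : Rabs (sin (x / 2)) <= 1) by (apply Rabs_le; generalize (SIN_bound (x / 2)); lra).
  unfold Rdiv in *. rewrite (Rabs_mult x), (Rabs_pos_eq (/ 2)) in H by lra.
  assert (H2 := Rabs_pos x). replace (x ^ 2) with (Rabs x * Rabs x).
  - split; nra.
  - rewrite <- Rabs_mult, Rabs_pos_eq; nra.
Qed.

Lemma Rabs_sin_minus (x : R) : Rabs (sin x - x) <= x ^ 2.
Proof.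
  destruct (MVT_gen (fun y => sin y - y) 0 x (fun y => cos y - 1)) as [c [Hc E]].
  - intros y _. auto_derive; auto. ring.
  - intros y _. apply continuity_pt_minus; [apply continuity_sin|].
    apply derivable_continuous_pt, derivable_pt_id.
  - rewrite sin_0, !Rminus_0_r in E. rewrite E, Rabs_mult.
    assert (Hcx : Rabs c <= Rabs x).
    { unfold Rmin, Rmax in Hc. destruct (Rle_dec 0 x).
      - rewrite !Rabs_pos_eq; lra.
      - rewrite !Rabs_left1; lra. }
    replace (x ^ 2) with (Rabs x * Rabs x) by (rewrite <- Rabs_mult, Rabs_pos_eq; nra).
    apply Rmult_le_compat_r; [apply Rabs_pos|].
    eapply Rle_trans; [apply Rabs_cos_minus_1|auto].
Qed.

Lemma Cmod_le_Re_Im (z : C) : Cmod z <= Rabs (Re z) + Rabs (Im z).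
Proof.
  unfold Cmod. apply Rle_trans with (sqrt (Rsqr (Rabs (Re z) + Rabs (Im z)))).
  - apply sqrt_le_1_alt. unfold Rsqr. fold (Re z) (Im z).
    rewrite <- (pow2_abs (Re z)), <- (pow2_abs (Im z)).
    assert (H := Rabs_pos (Re z)). assert (H' := Rabs_pos (Im z)). nra.
  - rewrite sqrt_Rsqr; [lra|]. generalize (Rabs_pos (Re z)) (Rabs_pos (Im z)); lra.
Qed.

(** Real and imaginary parts are treated apart, regrouped so that each summand is a remainder of
    [exp], [cos] or [sin], or a product of two first-order terms. The constant [3] is [1] from the
    real part plus [2] from the imaginary part. *)
Lemma Cmod_Cexp_taylor (z : C) :
  Cmod (Cexp z - 1 - z)%C <= 3 * Cmod z ^ 2 * exp (Cmod z).
Proof.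
  eapply Rle_trans; [apply Cmod_le_Re_Im|].
  assert (Hr := Cmod2_alt z). assert (Hx : Rabs (Re z) <= Cmod z) by apply re_le_Cmod.
  set (r := Cmod z) in *.
  assert (Hr0 : 0 <= r) by apply Cmod_ge_0.
  replace (Re (Cexp z - 1 - z)%C) with (exp (Re z) - 1 - Re z + exp (Re z) * (cos (Im z) - 1))
    by (unfold Cexp, Cminus, Cplus, Copp, RtoC, Re, Im; simpl; ring).
  replace (Im (Cexp z - 1 - z)%C) with ((exp (Re z) - 1) * sin (Im z) + (sin (Im z) - Im z))
    by (unfold Cexp, Cminus, Cplus, Copp, RtoC, Re, Im; simpl; ring).
  set (x := Re z) in *. set (y := Im z) in *.
  assert (HE : 1 <= exp r) by (generalize (exp_ge_1_plus r); lra).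
  assert (Hxr : exp (Rabs x) <= exp r).
  { destruct Hx as [H|H]; [left; now apply exp_increasing|rewrite H; lra]. }
  assert (Hx0 := Rle_trans _ _ _ (exp_Rabs_le x) Hxr).
  assert (Hy : Rabs y <= r).
  { apply Rsqr_incr_0; auto using Rabs_pos. rewrite <- Rsqr_abs. unfold Rsqr. nra. }
  assert (A1 := Rabs_exp_minus_1 x). assert (A2 := Rabs_exp_minus_1_minus x).
  assert (A3 := Rabs_sin_le y). assert (A4 := proj1 (Rabs_cos_minus_1 y)). assert (A5 := Rabs_sin_minus y).
  assert (B1 : Rabs (exp x - 1 - x + exp x * (cos y - 1)) <= r ^ 2 * exp r).
  { eapply Rle_trans; [apply Rabs_triang|]. rewrite Rabs_mult, (Rabs_pos_eq (exp x)) by (left; apply exp_pos).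
    assert (x ^ 2 * exp (Rabs x) <= x ^ 2 * exp r) by (apply Rmult_le_compat_l; auto; nra).
    assert (exp x * Rabs (cos y - 1) <= exp r * y ^ 2).
    { apply Rmult_le_compat; auto using Rabs_pos. left; apply exp_pos. }
    rewrite Hr. lra. }
  assert (B2 : Rabs ((exp x - 1) * sin y + (sin y - y)) <= 2 * r ^ 2 * exp r).
  { eapply Rle_trans; [apply Rabs_triang|]. rewrite Rabs_mult.
    assert (Rabs (exp x - 1) * Rabs (sin y) <= (r * exp r) * r).
    { apply Rmult_le_compat; auto using Rabs_pos; [|lra].
      eapply Rle_trans; [exact A1|]. apply Rmult_le_compat; auto using Rabs_pos. left; apply exp_pos. }
    assert (r ^ 2 <= r ^ 2 * exp r) by nra.
    assert (y ^ 2 <= r ^ 2) by nra. lra. }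
  lra.
Qed.

(** Differentiation term by term: [l] is the sum of [-log(n+1) a_n (n+1)^(-s)], and the termwise
    Taylor remainders add up to [K |h|^2]. *)
Lemma analytic_on_represents (theta : R) (a : nat -> C) (f : C -> C) :
  abs_conv theta a -> represents theta a f -> analytic_on theta f.
Proof.
  intros Ha Hf s Hs. unfold half_plane in Hs.
  (* A margin of [3 d]: one [d] pays for the squared logarithm, one for [exp (|h| L n)] with
     [|h| <= d], and the last keeps [Re s - 2 d] to the right of [theta]. *)
  set (d := (Re s - theta) / 3). assert (Hd : 0 < d) by (unfold d; lra).
  set (L := fun n => ln (INR (S n))).
  assert (HL : forall n, 0 <= L n).
  { intros n. unfold L. rewrite <- ln_1. apply ln_le; [lra|apply INR_S_ge1]. }
  set (A := A_term (Re s - 2 * d) a).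
  assert (HA : ex_series A) by (apply Ha; unfold d; lra).
  assert (HAs : forall n t, A_term (Re s) a n * exp (t * L n) = A_term (Re s - t) a n).
  { intros n t. unfold A_term. rewrite Rmult_assoc. f_equal.
    change (exp (t * L n)) with (Rpower (INR (S n)) t). rewrite <- Rpower_plus. f_equal. ring. }
  assert (HL1 : forall n, L n <= / d * exp (d * L n)).
  { intros n. apply Rmult_le_reg_l with d; auto. rewrite <- Rmult_assoc, Rinv_r, Rmult_1_l by lra.
    generalize (exp_ge_1_plus (d * L n)); lra. }
  destruct (ex_series_C (fun n => (- RtoC (L n) * (a n * dpow n s))%C)) as [l Hl].
  { apply ex_series_le_R with (fun n => / d * A n).
    - intros n. split; [apply Cmod_ge_0|].
      rewrite Cmod_mult, Cmod_opp, Cmod_R, Rabs_pos_eq, Cmod_dterm by auto.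
      apply Rle_trans with (/ d * exp (d * L n) * A_term (Re s) a n).
      + apply Rmult_le_compat_r; auto using A_term_ge0.
      + rewrite Rmult_assoc. apply Rmult_le_compat_l; [left; now apply Rinv_0_lt_compat|].
        rewrite Rmult_comm, HAs. apply A_term_anti. lra.
    - now apply (ex_series_scal (K := R_AbsRing) (V := R_NormedModule) (/ d)). }
  exists l. split; [apply is_linear_scal_l|].
  intros x0 Hx0. rewrite <- (is_filter_lim_locally_unique _ _ Hx0). clear x0 Hx0.
  (* [12 = 3 * 4]: the [3] of [Cmod_Cexp_taylor] and the [4 / d^2] of [Q2], which squares
     [d L / 2 <= exp (d L / 2)]. *)
  set (K := 12 * / d ^ 2 * Series A).
  assert (HK : 0 <= K).
  { unfold K. apply Rmult_le_pos.
    - apply Rmult_le_pos; [lra|]. left. apply Rinv_0_lt_compat. nra.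
    - apply Rle_trans with (sum_n A 0); [rewrite sum_O; apply A_term_ge0|].
      apply sum_n_Series_le; auto. intros; apply A_term_ge0. }
  assert (Main : forall h : C, Cmod h <= d -> Cmod (f (s + h) - f s - h * l)%C <= K * Cmod h ^ 2).
  { intros h Hh.
    assert (Hsh : half_plane theta (s + h)).
    { unfold half_plane. assert (T := re_le_Cmod h). apply Rabs_le_between in T.
      unfold d in Hh. replace (Re (s + h)%C) with (Re s + Re h) by reflexivity. lra. }
    assert (HS := is_series_minus (K := C_AbsRing) (V := C_NormedModule) _ _ _ _
      (is_series_minus (K := C_AbsRing) (V := C_NormedModule) _ _ _ _ (Hf _ Hsh) (Hf s Hs))
      (is_series_scal (K := C_AbsRing) (V := C_NormedModule) h _ _ Hl)).
    refine (is_series_C_Cmod_le _ _ _ HS _). intros N. exists N. split; auto.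
    eapply Rle_trans; [apply Cmod_sum_n|].
    apply Rle_trans with (sum_n (fun n => 12 * / d ^ 2 * Cmod h ^ 2 * A n) N).
    2:{ rewrite sum_n_scal. unfold K.
        assert (sum_n A N <= Series A) by (apply sum_n_Series_le; auto; intros; apply A_term_ge0).
        replace (12 * / d ^ 2 * Series A * Cmod h ^ 2) with (12 * / d ^ 2 * Cmod h ^ 2 * Series A) by ring.
        apply Rmult_le_compat_l; auto. apply Rmult_le_pos; [|apply pow2_ge_0].
        apply Rmult_le_pos; [lra|]. left. apply Rinv_0_lt_compat. nra. }
    apply sum_n_le. intros n _.
    set (z := (- h * RtoC (L n))%C).
    assert (Hz : Cmod z = Cmod h * L n).
    { unfold z. now rewrite Cmod_mult, Cmod_opp, Cmod_R, Rabs_pos_eq. }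
    match goal with |- Cmod ?t <= _ => replace t with ((a n * dpow n s) * (Cexp z - 1 - z))%C end.
    2:{ rewrite dpow_plus. change (dpow n h) with (Cexp z).
        change scal with Cmult. change plus with Cplus. change opp with Copp.
        unfold z. match goal with |- ?x = ?y => change (@eq C x y) end. ring. }
    rewrite Cmod_mult, Cmod_dterm.
    assert (T := Cmod_Cexp_taylor z). rewrite Hz in T.
    assert (HA0 := A_term_ge0 (Re s) a n).
    eapply Rle_trans; [apply Rmult_le_compat_l; [exact HA0|exact T]|].
    assert (HAn : A n = A_term (Re s) a n * exp (d * L n) * exp (d * L n)).
    { rewrite Rmult_assoc, <- exp_plus. unfold A. rewrite <- HAs. do 2 f_equal. ring. }
    rewrite HAn.
    assert (Q1 : exp (Cmod h * L n) <= exp (d * L n)).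
    { assert (Q : Cmod h * L n <= d * L n) by (apply Rmult_le_compat_r; auto).
      destruct Q as [Q|Q]; [left; now apply exp_increasing|rewrite Q; lra]. }
    assert (Q2 : L n ^ 2 <= 4 * / d ^ 2 * exp (d * L n)).
    { replace (d * L n) with (d * (L n / 2) + d * (L n / 2)) by field.
      rewrite exp_plus. assert (Q := exp_ge_1_plus (d * (L n / 2))).
      assert (HLn := HL n). set (e := exp (d * (L n / 2))) in *.
      apply Rmult_le_reg_l with (d ^ 2); [nra|].
      replace (d ^ 2 * (4 * / d ^ 2 * (e * e))) with (4 * (e * e)) by (field; lra).
      assert (0 <= d * (L n / 2)) by (apply Rmult_le_pos; lra).
      replace (d ^ 2 * L n ^ 2) with (4 * (d * (L n / 2) * (d * (L n / 2)))) by field.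
      nra. }
    replace (12 * / d ^ 2 * Cmod h ^ 2 * (A_term (Re s) a n * exp (d * L n) * exp (d * L n)))
      with (A_term (Re s) a n * (3 * (Cmod h ^ 2 * (4 * / d ^ 2 * exp (d * L n))) * exp (d * L n))) by ring.
    apply Rmult_le_compat_l; auto. rewrite Rpow_mult_distr.
    apply Rmult_le_compat; auto.
    - apply Rmult_le_pos; [lra|]. apply Rmult_le_pos; apply pow2_ge_0.
    - left; apply exp_pos.
    - apply Rmult_le_compat_l; [lra|]. apply Rmult_le_compat_l; [apply pow2_ge_0|auto]. }
  intros eps.
  assert (He : 0 < Rmin d (eps / (K + 1))).
  { apply Rmin_pos; auto. apply Rdiv_lt_0_compat; [apply cond_pos|lra]. }
  exists (mkposreal _ He). intros y Hy.
  set (h := (y - s)%C). assert (Hh : Cmod h < Rmin d (eps / (K + 1))) by exact Hy.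
  assert (H1 := Rlt_le_trans _ _ _ Hh (Rmin_l _ _)). assert (H2 := Rlt_le_trans _ _ _ Hh (Rmin_r _ _)).
  assert (M := Main h ltac:(lra)).
  change C in y. assert (E : @eq C (s + h)%C y) by (unfold h; ring). rewrite E in M.
  eapply Rle_trans; [exact M|]. change (norm (minus y s)) with (Cmod h).
  replace (K * Cmod h ^ 2) with (K * Cmod h * Cmod h) by ring.
  apply Rmult_le_compat_r; [apply Cmod_ge_0|].
  assert (Hh0 := Cmod_ge_0 h).
  apply Rle_trans with ((K + 1) * (eps / (K + 1))); [|right; field; lra].
  apply Rmult_le_compat; lra.
Qed.

(** * Absolutely convergent series are multipliers *)

Lemma conjugate_bounds (p q : R) : 1 < p -> 1 / p + 1 / q = 1 -> 0 < 1 / p < 1 /\ 0 < 1 / q < 1.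
Proof.
  intros Hp Hpq. assert (0 < 1 / p) by (apply Rdiv_lt_0_compat; lra).
  assert (1 / p < 1).
  { unfold Rdiv. rewrite Rmult_1_l, <- Rinv_1. apply Rinv_lt_contravar; lra. }
  lra.
Qed.

Lemma Series_ge0 (u : nat -> R) : (forall n, 0 <= u n) -> ex_series u -> 0 <= Series u.
Proof.
  intros H Hu. apply Rle_trans with (sum_n u 0); [rewrite sum_O; auto|].
  now apply sum_n_Series_le.
Qed.

Lemma ces_norm_ge0 (p : R) (a : nat -> C) : 0 <= ces_norm p a.
Proof. apply rpow_ge0. Qed.

Lemma ces_norm_le (p M : R) (a : nat -> C) : 1 < p -> 0 < M -> in_ces p a ->
  (forall N, sum_n (ces_term p a) N <= Rpower M p) -> ces_norm p a <= M.
Proof.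
  intros Hp HM Ha H. unfold ces_norm.
  apply Rle_trans with (rpow (rpow M p) (1 / p)).
  - apply rpow_le; [apply Rlt_le, Rdiv_lt_0_compat; lra|]. rewrite rpow_pos by auto.
    now apply Series_le_bound.
  - right. apply rpow_rpow; [lra|]. field. lra.
Qed.

Lemma sum_n_ces_term_le (p M : R) (a : nat -> C) (N : nat) : 1 < p -> 0 < M -> in_ces p a ->
  ces_norm p a <= M -> sum_n (ces_term p a) N <= Rpower M p.
Proof.
  intros Hp HM Ha H. eapply Rle_trans; [apply sum_n_Series_le; auto using ces_term_ge0|].
  rewrite <- rpow_pos by auto.
  rewrite <- (rpow_rpow (Series (ces_term p a)) (1 / p) p).
  - apply rpow_le; [lra|exact H].
  - apply Series_ge0; auto using ces_term_ge0.
  - field. lra.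
Qed.

Lemma ces_term_scal (p : R) (c : C) (a : nat -> C) (n : nat) :
  ces_term p (fun k => (c * a k)%C) n = rpow (Cmod c) p * ces_term p a n.
Proof.
  unfold ces_term. rewrite <- rpow_mult_distr; [|apply Cmod_ge_0|].
  - f_equal. transitivity (/ INR (S n) * (Cmod c * sum_n (fun k => Cmod (a k)) n)); [|ring].
    f_equal. rewrite <- sum_n_scal. apply sum_n_ext; intros. apply Cmod_mult.
  - apply Rmult_le_pos; [left; apply Rinv_0_lt_compat, INR_S_gt0|apply sum_n_Cmod_ge0].
Qed.

Lemma in_ces_scal (p : R) (c : C) (a : nat -> C) : in_ces p a -> in_ces p (fun k => (c * a k)%C).
Proof.
  intros H. unfold in_ces. apply ex_series_ext with (fun n => rpow (Cmod c) p * ces_term p a n).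
  - intros n. symmetry. apply ces_term_scal.
  - now apply (ex_series_scal (K := R_AbsRing) (V := R_NormedModule) (rpow (Cmod c) p)).
Qed.

Lemma ces_norm_scal (p : R) (c : C) (a : nat -> C) : 1 < p -> in_ces p a ->
  ces_norm p (fun k => (c * a k)%C) = Cmod c * ces_norm p a.
Proof.
  intros Hp Ha. unfold ces_norm.
  rewrite (Series_ext _ (fun n => rpow (Cmod c) p * ces_term p a n)) by (intros; apply ces_term_scal).
  rewrite Series_scal_l, rpow_mult_distr; auto using rpow_ge0.
  - rewrite rpow_rpow; auto using Cmod_ge_0. field; lra.
  - apply Series_ge0; auto using ces_term_ge0.
Qed.

Lemma ces_term_le (p : R) (a b : nat -> C) (n : nat) : 1 < p ->
  (forall k, (k <= n)%nat -> Cmod (a k) <= Cmod (b k)) -> ces_term p a n <= ces_term p b n.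
Proof.
  intros Hp H. apply rpow_le; [lra|].
  apply Rmult_le_compat_l; [left; apply Rinv_0_lt_compat, INR_S_gt0|]. now apply sum_n_le.
Qed.

(** Serves as triangle inequality for finite combinations: with weights [1, 1] for two summands,
    with weights [2^(-j)] for the stages of the gliding hump. *)
Lemma ces_term_Jensen (p W : R) (w : nat -> R) (e : nat -> nat -> C) (x : nat -> C) (J n : nat) :
  1 < p -> 0 < W -> (forall j, 0 <= w j) -> sum_n w J <= W ->
  (forall k, (k <= n)%nat -> Cmod (x k) <= sum_n (fun j => w j * Cmod (e j k)) J) ->
  ces_term p x n <= Rpower W (p - 1) * sum_n (fun j => w j * ces_term p (e j) n) J.
Proof.
  intros Hp HW Hw HwW Hx. unfold ces_term at 2.
  eapply Rle_trans; [|apply (rpow_Jensen p W w (fun j => / INR (S n) * sum_n (fun k => Cmod (e j k)) n) J); auto].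
  2:{ intros j. apply Rmult_le_pos; [left; apply Rinv_0_lt_compat, INR_S_gt0|apply sum_n_Cmod_ge0]. }
  apply rpow_le; [lra|].
  apply Rle_trans with (/ INR (S n) * sum_n (fun j => w j * sum_n (fun k => Cmod (e j k)) n) J).
  - apply Rmult_le_compat_l; [left; apply Rinv_0_lt_compat, INR_S_gt0|].
    eapply Rle_trans; [apply sum_n_le; exact Hx|]. right. rewrite sum_n_switch.
    apply sum_n_ext; intros j. apply sum_n_scal.
  - right. rewrite <- sum_n_scal. apply sum_n_ext; intros j. apply Rminus_diag_uniq; ring.
Qed.

Lemma ces_term_triangle (p : R) (x y z : nat -> C) (n : nat) : 1 < p ->
  (forall k, Cmod (z k) <= Cmod (x k) + Cmod (y k)) ->
  ces_term p z n <= Rpower 2 (p - 1) * (ces_term p x n + ces_term p y n).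
Proof.
  intros Hp H.
  set (e := fun j : nat => match j with O => x | _ => y end).
  eapply Rle_trans; [apply (ces_term_Jensen p 2 (fun _ => 1) e z 1 n); auto; try (intros; lra)|].
  - rewrite sum_n_S, sum_O. lra.
  - intros k _. rewrite sum_n_S, sum_O. unfold e. specialize (H k). lra.
  - rewrite sum_n_S, sum_O. unfold e. right. ring.
Qed.

Lemma in_ces_bound (p : R) (b : nat -> C) : 1 < p -> in_ces p b ->
  exists M, 0 < M /\ ces_norm p b <= M.
Proof.
  intros Hp Hb. exists (ces_norm p b + 1). generalize (ces_norm_ge0 p b); lra.
Qed.

(** [K] is chosen before [M] and [b]: this is boundedness of point evaluation on the line
    [Re s = sg]. *)
Lemma A_term_bound (p q sg : R) : 1 < p -> 1 / p + 1 / q = 1 -> 1 / q < sg ->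
  exists K, forall (M : R) (b : nat -> C), 0 < M ->
    (forall N, sum_n (ces_term p b) N <= Rpower M p) ->
    forall N, sum_n (A_term sg b) N <= K * M.
Proof.
  intros Hp Hpq Hsg. eexists. intros M b HM Hb N.
  apply (Abel_bound sg (1 / q) M b N); auto.
  - destruct (conjugate_bounds p q Hp Hpq); lra.
  - intros n. now apply (ces_growth p).
Qed.

Lemma ces_abs_conv (p q : R) (b : nat -> C) : 1 < p -> 1 / p + 1 / q = 1 ->
  in_ces p b -> abs_conv (1 / q) b.
Proof.
  intros Hp Hpq Hb sg Hsg. destruct (in_ces_bound p b Hp Hb) as [M [HM HbM]].
  destruct (A_term_bound p q sg Hp Hpq Hsg) as [K HK].
  apply ex_series_bounded with (K * M); [apply A_term_ge0|].
  apply HK; auto. intros N. now apply sum_n_ces_term_le.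
Qed.

Lemma represents_exists (theta : R) (a : nat -> C) : abs_conv theta a ->
  exists f, represents theta a f.
Proof.
  intros Ha.
  exists (fun s => epsilon (inhabits (RtoC 0)) (fun l =>
    is_series (K := C_AbsRing) (V := C_NormedModule) (fun n => (a n * dpow n s)%C) l)).
  intros s Hs. apply epsilon_spec. apply ex_series_C. eapply ex_series_Cmod_dterm; eauto.
Qed.

Lemma ces_dconv (p q W : R) (a b : nat -> C) : 1 < p -> 1 / p + 1 / q = 1 ->
  ex_series (A_term (1 / q) a) -> 0 < W -> Series (A_term (1 / q) a) <= W -> in_ces p b ->
  in_ces p (dconv (K := C_Ring) a b) /\
  ces_norm p (dconv (K := C_Ring) a b) <= W * ces_norm p b.
Proof.
  intros Hp Hpq Ha HW HaW Hb.
  assert (H : forall N, sum_n (ces_term p (dconv (K := C_Ring) a b)) N <= rpow W p * Series (ces_term p b)).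
  { intros N. eapply Rle_trans; [apply (sum_n_ces_term_dconv p q W a b N); auto|].
    - eapply Rle_trans; [apply sum_n_Series_le; auto using A_term_ge0|auto].
    - rewrite rpow_pos by auto. apply Rmult_le_compat_l; [left; apply Rpower_gt0|].
      apply sum_n_Series_le; auto using ces_term_ge0. }
  assert (Hi : in_ces p (dconv (K := C_Ring) a b)) by (eapply ex_series_bounded; eauto using ces_term_ge0).
  split; auto. unfold ces_norm.
  rewrite <- (rpow_rpow W p (1 / p)) by (lra || (field; lra)).
  rewrite <- rpow_mult_distr.
  - apply rpow_le; [apply Rlt_le, Rdiv_lt_0_compat; lra|]. now apply Series_le_bound.
  - apply rpow_ge0.
  - apply Series_ge0; auto using ces_term_ge0.
Qed.

Lemma A_multiplier (p q : R) (f : C -> C) : 1 < p -> 1 / p + 1 / q = 1 ->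
  in_A (1 / q) f -> multiplier p q f.
Proof.
  intros Hp Hpq [a [Ha Hf]].
  assert (Haa : abs_conv (1 / q) a).
  { intros sg Hsg. apply ex_series_A_term_anti with (1 / q); auto; lra. }
  split; [now apply analytic_on_represents with a|].
  intros g [b [Hb Hg]]. exists (dconv (K := C_Ring) a b). split.
  - apply (ces_dconv p q (Series (A_term (1 / q) a) + 1)); auto; try lra.
    assert (0 <= Series (A_term (1 / q) a)) by (apply Series_ge0; auto using A_term_ge0). lra.
  - apply represents_dconv; auto. now apply ces_abs_conv with p.
Qed.

Lemma A_multiplier_norm (p q : R) (f : C -> C) : 1 < p -> 1 / p + 1 / q = 1 ->
  in_A (1 / q) f -> Rbar_le (multiplier_norm p q f) (Finite (A_norm (1 / q) f)).
Proof.
  intros Hp Hpq [a [Ha Hf]]. unfold multiplier_norm, A_norm.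
  rewrite (dcoef_represents _ a f Hf).
  assert (H0 : 0 <= Series (A_term (1 / q) a)) by (apply Series_ge0; auto using A_term_ge0).
  apply (proj2 (Lub_Rbar_correct _)). intros x [g [[b [Hb Hg]] [Hgn ->]]].
  unfold Hces_norm in *. rewrite (dcoef_represents _ b g Hg) in Hgn.
  assert (Haa : abs_conv (1 / q) a).
  { intros sg Hsg. apply ex_series_A_term_anti with (1 / q); auto; lra. }
  rewrite (dcoef_represents _ (dconv (K := C_Ring) a b)).
  (* [ces_dconv] asks for a positive [W], but the [A] norm vanishes for [f = 0]; hence the added
     [eps]. *)
  - simpl. apply le_epsilon. intros eps Heps.
    destruct (ces_dconv p q (Series (A_term (1 / q) a) + eps) a b) as [_ H]; auto; try lra.
    eapply Rle_trans; [exact H|].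
    rewrite <- (Rmult_1_r (Series (A_term (1 / q) a) + eps)) at 2.
    apply Rmult_le_compat_l; lra.
  - apply represents_dconv; auto. now apply ces_abs_conv with p.
Qed.

(** * Multipliers act boundedly *)

Lemma dconv_comm (a b : nat -> C) (n : nat) :
  dconv (K := C_Ring) a b n = dconv (K := C_Ring) b a n.
Proof.
  unfold dconv. rewrite sum_n_switch. apply sum_n_ext; intros j. apply sum_n_ext; intros k.
  rewrite (Nat.mul_comm (S k)). destruct Nat.eq_dec; auto. apply Cmult_comm.
Qed.

Lemma dconv_lin (a x y : nat -> C) (c : C) (n : nat) :
  dconv (K := C_Ring) a (fun k => (x k + c * y k)%C) n
  = (dconv (K := C_Ring) a x n + c * dconv (K := C_Ring) a y n)%C.
Proof.
  unfold dconv.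
  etransitivity; [|apply f_equal, (sum_n_mult_l (K := C_Ring))].
  etransitivity; [|apply (sum_n_plus (G := C_AbelianMonoid))].
  apply sum_n_ext; intros k.
  etransitivity; [|apply f_equal, (sum_n_mult_l (K := C_Ring))].
  etransitivity; [|apply (sum_n_plus (G := C_AbelianMonoid))].
  apply sum_n_ext; intros j.
  change plus with Cplus. change (@mult C_Ring) with Cmult. change (@zero C_Ring) with (RtoC 0).
  match goal with |- ?x = ?y => change (@eq C x y) end.
  destruct Nat.eq_dec; ring.
Qed.

Lemma dconv_ext (a x y : nat -> C) (n : nat) : (forall k, (k <= n)%nat -> x k = y k) ->
  dconv (K := C_Ring) a x n = dconv (K := C_Ring) a y n.
Proof.
  intros H. apply sum_n_ext; intros k. apply sum_n_ext_loc; intros j Hj. now rewrite (H j Hj).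
Qed.

Lemma ces_term_ext (p : R) (a b : nat -> C) (n : nat) :
  (forall k, (k <= n)%nat -> a k = b k) -> ces_term p a n = ces_term p b n.
Proof.
  intros H. unfold ces_term. do 2 f_equal. apply sum_n_ext_loc; intros. now rewrite H.
Qed.

Lemma sum_n_ces_term_triangle (p : R) (x y z : nat -> C) (N : nat) : 1 < p ->
  (forall k, Cmod (z k) <= Cmod (x k) + Cmod (y k)) ->
  sum_n (ces_term p z) N
  <= Rpower 2 (p - 1) * (sum_n (ces_term p x) N + sum_n (ces_term p y) N).
Proof.
  intros Hp H. rewrite <- sum_n_add, <- sum_n_scal. apply sum_n_le; intros n _.
  now apply ces_term_triangle.
Qed.

Lemma sum_n_ces_term_scal (p : R) (c : C) (a : nat -> C) (N : nat) :
  sum_n (ces_term p (fun k => (c * a k)%C)) N = rpow (Cmod c) p * sum_n (ces_term p a) N.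
Proof. rewrite <- sum_n_scal. apply sum_n_ext; intros. apply ces_term_scal. Qed.

Section GlidingHump.

Variables (p q : R) (a : nat -> C).
Hypotheses (Hp : 1 < p) (Hpq : 1 / p + 1 / q = 1) (Ha : in_ces p a).

(** The unit ball of [ces_p] and the truncated [p]-th power of the norm of the image of [b], both
    phrased by partial sums so that they are meaningful even when the image is not in [ces_p]. *)
Let ball (b : nat -> C) : Prop := forall N, sum_n (ces_term p b) N <= 1.
Let energy (b : nat -> C) (N : nat) : R := sum_n (ces_term p (dconv (K := C_Ring) a b)) N.

Hypothesis unbounded : forall K, exists b N, ball b /\ K < energy b N.

Let head (n : nat) (b : nat -> C) (k : nat) : C := if le_dec k n then b k else RtoC 0.
Let tail (n : nat) (b : nat -> C) (k : nat) : C := if le_dec k n then RtoC 0 else b k.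

(** The roles are exchanged: on the ball the first [n+1] coefficients of [b] have bounded [l^1] norm
    by [ces_growth], so [head n b] acts on [a] as an element of [A^(1/q)] with bounded norm. *)
Lemma energy_head (n : nat) : exists B, forall b N, ball b -> energy (head n b) N <= B.
Proof.
  set (W := 2 * 1 * Rpower (INR (S n)) (1 / q)).
  assert (HW : 0 < W) by (unfold W; generalize (Rpower_gt0 (INR (S n)) (1 / q)); lra).
  exists (Rpower W p * Series (ces_term p a)). intros b N Hb.
  apply Rle_trans with (sum_n (ces_term p (dconv (K := C_Ring) (head n b) a)) N).
  { right. apply sum_n_ext; intros m. apply ces_term_ext. intros k _. apply dconv_comm. }
  eapply Rle_trans; [apply (sum_n_ces_term_dconv p q W); auto|].
  - apply Rle_trans with (sum_n (fun k => Cmod (b k)) n).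
    2:{ apply (ces_growth p q 1 b n); auto; try lra. intros M.
        unfold Rpower at 1. rewrite ln_1, Rmult_0_r, exp_0. apply Hb. }
    apply Rle_trans with (sum_n (fun k => Cmod (head n b k)) N).
    + apply sum_n_le; intros k _. unfold A_term.
      assert (H1 : Rpower (INR (S k)) (- (1 / q)) <= Rpower (INR (S k)) 0).
      { apply Rle_Rpower; [apply INR_S_ge1|]. destruct (conjugate_bounds p q Hp Hpq); lra. }
      rewrite Rpower_O in H1 by apply INR_S_gt0. generalize (Cmod_ge_0 (head n b k)); nra.
    + apply Rle_trans with (sum_n (fun k => Cmod (head n b k)) (max n N)).
      { apply sum_n_le_n; [intros; apply Cmod_ge_0|lia]. }
      rewrite (sum_n_extend _ n); [|lia|].
      * right. apply sum_n_ext_loc; intros k Hk. unfold head. destruct le_dec; [auto|lia].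
      * intros k Hk. unfold head. destruct le_dec; [lia|apply Cmod_0].
  - apply Rmult_le_compat_l; [left; apply Rpower_gt0|].
    apply sum_n_Series_le; auto using ces_term_ge0.
Qed.

(** Since heads have bounded energy, unboundedness persists on sequences that vanish up to any given
    index. *)
Lemma energy_tail (n : nat) (K : R) : exists b N, ball b /\ K < energy (tail n b) N.
Proof.
  destruct (energy_head n) as [B HB].
  destruct (unbounded (Rpower 2 (p - 1) * (B + K))) as [b [N [Hb H]]].
  exists b, N. split; auto.
  assert (T := sum_n_ces_term_triangle p (dconv (K := C_Ring) a (head n b))
    (dconv (K := C_Ring) a (tail n b)) (dconv (K := C_Ring) a b) N Hp).
  fold (energy b N) (energy (head n b) N) (energy (tail n b) N) in T.
  specialize (HB b N Hb).
  assert (H2 := Rpower_gt0 2 (p - 1)).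
  apply Rplus_lt_reg_l with B. apply Rmult_lt_reg_l with (Rpower 2 (p - 1)); auto.
  eapply Rlt_le_trans; [exact H|]. eapply Rle_trans; [apply T|].
  - intros k. rewrite <- (Rmult_1_l (Cmod (dconv _ (tail n b) k))), <- Cmod_1, <- Cmod_mult.
    rewrite (dconv_ext a b (fun k => (head n b k + 1 * tail n b k)%C)).
    + rewrite dconv_lin. apply Cmod_triangle.
    + intros j _. unfold head, tail. destruct le_dec; ring.
  - apply Rmult_le_compat_l; lra.
Qed.

(* Either sign works: [T y] is half the difference of [T (x + y)] and [T (x - y)]. *)
Lemma hump_step (x : nat -> C) (n : nat) (w K : R) : 0 < w -> exists x' m e,
  (n < m)%nat /\ (forall k, (k <= n)%nat -> x' k = x k) /\ ball e /\
  (forall k, Cmod (x' k) <= Cmod (x k) + w * Cmod (e k)) /\ K <= energy x' m.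
Proof.
  intros Hw. destruct (energy_tail n (K / rpow w p)) as [b [N [Hb H]]].
  assert (Hwp : 0 < rpow w p) by (rewrite rpow_pos by auto; apply Rpower_gt0).
  set (xs := fun (c : C) k => (x k + c * tail n b k)%C).
  (* Here [2 w T(tail) = T(xs w) - T(xs (-w))]. The factor [2^p] from scaling by [2 w] exceeds the
     quasi-triangle constant [2^(p-1)] by exactly [2], so one of the two signs has energy at least
     [K]. *)
  assert (Hsum : 2 * K <= energy (xs (RtoC w)) N + energy (xs (- RtoC w)%C) N).
  { assert (T := sum_n_ces_term_triangle p (dconv (K := C_Ring) a (xs (RtoC w)))
      (dconv (K := C_Ring) a (xs (- RtoC w)%C))
      (fun k => (RtoC (2 * w) * dconv (K := C_Ring) a (tail n b) k)%C) N Hp).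
    fold (energy (xs (RtoC w)) N) (energy (xs (- RtoC w)%C) N) in T.
    rewrite sum_n_ces_term_scal in T. fold (energy (tail n b) N) in T.
    rewrite Cmod_R, Rabs_pos_eq, rpow_mult_distr in T by lra.
    assert (H2 := Rpower_gt0 2 (p - 1)).
    apply Rmult_le_reg_l with (Rpower 2 (p - 1)); auto.
    eapply Rle_trans; [|apply T].
    - rewrite (rpow_pos 2) by lra. replace p with (p - 1 + 1) at 2 by ring.
      rewrite Rpower_plus, Rpower_1 by lra.
      replace (Rpower 2 (p - 1) * (2 * K)) with (Rpower 2 (p - 1) * 2 * K) by ring.
      rewrite (Rmult_assoc _ (rpow w p)). apply Rmult_le_compat_l; [lra|].
      apply Rlt_le in H. apply Rmult_le_compat_l with (r := rpow w p) in H; [|lra].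
      replace (rpow w p * (K / rpow w p)) with K in H by (field; lra). exact H.
    - intros k. unfold xs. rewrite !dconv_lin.
      set (u := dconv _ x k). set (v := dconv _ (tail n b) k).
      rewrite <- (Cmod_opp (u + - RtoC w * v)%C).
      replace (RtoC (2 * w) * v)%C with ((u + RtoC w * v) + - (u + - RtoC w * v))%C.
      + apply Cmod_triangle.
      + rewrite RtoC_mult. clearbody u v. change C in u, v.
        match goal with |- ?x = ?y => change (@eq C x y) end. ring. }
  assert (Hc : exists c, Cmod c = w /\ K <= energy (xs c) N).
  { destruct (Rle_dec K (energy (xs (RtoC w)) N)).
    - exists (RtoC w). split; auto. rewrite Cmod_R. apply Rabs_pos_eq; lra.
    - exists (- RtoC w)%C. split; [|lra]. rewrite Cmod_opp, Cmod_R. apply Rabs_pos_eq; lra. }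
  destruct Hc as [c [Hcw HcK]].
  exists (xs c), (max N (S n)), (tail n b). repeat split.
  - lia.
  - intros k Hk. unfold xs, tail. destruct le_dec; [ring|lia].
  - intros M. eapply Rle_trans; [|apply (Hb M)]. apply sum_n_le; intros i _.
    apply ces_term_le; auto. intros k _. unfold tail. destruct le_dec; [|lra].
    rewrite Cmod_0. apply Cmod_ge_0.
  - intros k. unfold xs. rewrite <- Hcw, <- Cmod_mult. apply Cmod_triangle.
  - eapply Rle_trans; [exact HcK|]. apply sum_n_le_n; [apply ces_term_ge0|lia].
Qed.

Lemma gliding_hump : exists x, in_ces p x /\ ~ in_ces p (dconv (K := C_Ring) a x).
Proof.
  set (w := fun j : nat => (1 / 2) ^ j).
  assert (Hw : forall j, 0 < w j) by (intros j; apply pow_lt; lra).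
  set (P := fun (j : nat) (st st' : (nat -> C) * nat) => exists e,
    (snd st < snd st')%nat /\ (forall k, (k <= snd st)%nat -> fst st' k = fst st k) /\ ball e /\
    (forall k, Cmod (fst st' k) <= Cmod (fst st k) + w j * Cmod (e k)) /\
    INR j <= energy (fst st') (snd st')).
  assert (step : forall j st, {st' | P j st st'}).
  { intros j st. apply constructive_indefinite_description.
    destruct (hump_step (fst st) (snd st) (w j) (INR j) (Hw j)) as [x' [m [e H]]].
    exists (x', m), e. exact H. }
  set (X := nat_rect (fun _ => ((nat -> C) * nat)%type) (fun _ => RtoC 0, 0%nat)
    (fun j st => proj1_sig (step j st))).
  assert (HX : forall j, P j (X j) (X (S j))) by (intros j; exact (proj2_sig (step j (X j)))).
  set (xx := fun j => fst (X j)). set (nn := fun j => snd (X j)).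
  assert (Hnn : forall j, (j <= nn j)%nat).
  { induction j as [|j IH]; [lia|]. destruct (HX j) as [e [H _]]. unfold nn in *. lia. }
  assert (Hstab : forall j i, (j <= i)%nat -> (nn j <= nn i)%nat /\ forall k, (k <= nn j)%nat -> xx i k = xx j k).
  { induction 1 as [|i Hji [IH1 IH2]]; [auto|]. destruct (HX i) as [e [H1 [H2 _]]].
    unfold nn, xx in *. split; [lia|]. intros k Hk. rewrite <- IH2 by auto. apply H2. lia. }
  (* Since [k <= nn k], coordinate [k] no longer changes after stage [k], so the diagonal is the
     limit. *)
  set (x := fun k => xx k k).
  assert (Hx : forall j k, (k <= nn j)%nat -> x k = xx j k).
  { intros j k Hk. unfold x. destruct (le_ge_dec j k) as [H|H].
    - now apply (proj2 (Hstab j k H)).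
    - symmetry. apply (proj2 (Hstab k j H)). apply Hnn. }
  set (e := fun j => proj1_sig (constructive_indefinite_description _ (HX j))).
  assert (He : forall j, ball (e j) /\ (forall k, Cmod (xx (S j) k) <= Cmod (xx j k) + w j * Cmod (e j k)) /\
    INR j <= energy (xx (S j)) (nn (S j))).
  { intros j. exact (proj2 (proj2 (proj2_sig (constructive_indefinite_description _ (HX j))))). }
  exists x. split.
  - apply ex_series_bounded with (Rpower 2 (p - 1) * 2); [apply ces_term_ge0|]. intros N.
    assert (Hxe : forall J k, Cmod (xx (S J) k) <= sum_n (fun j => w j * Cmod (e j k)) J).
    { intros J k. induction J as [|J IH].
      - rewrite sum_O. destruct (He 0%nat) as [_ [H _]]. specialize (H k).
        change (xx 0%nat k) with (RtoC 0) in H. rewrite Cmod_0 in H. lra.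
      - rewrite sum_n_S. destruct (He (S J)) as [_ [H _]]. specialize (H k). lra. }
    assert (HW : forall J, sum_n w J <= 2 - w J).
    { induction J as [|J IH]; [rewrite sum_O; unfold w; simpl; lra|]. rewrite sum_n_S.
      unfold w in *. simpl pow. lra. }
    apply Rle_trans with (sum_n (fun n => Rpower 2 (p - 1) * sum_n (fun j => w j * ces_term p (e j) n) N) N).
    + apply sum_n_le; intros n Hn. apply ces_term_Jensen; auto; try lra.
      * intros; left; apply Hw.
      * specialize (HW N). specialize (Hw N). lra.
      * intros k Hk. rewrite (Hx (S N) k); [apply Hxe|]. specialize (Hnn (S N)). lia.
    + rewrite sum_n_scal. apply Rmult_le_compat_l; [left; apply Rpower_gt0|].
      rewrite sum_n_switch. apply Rle_trans with (sum_n w N).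
      * apply sum_n_le; intros j _. rewrite sum_n_scal. rewrite <- (Rmult_1_r (w j)) at 2.
        apply Rmult_le_compat_l; [left; apply Hw|]. apply He.
      * specialize (HW N). specialize (Hw N). lra.
  - intros Hc.
    assert (Hj : forall j, INR j <= Series (ces_term p (dconv (K := C_Ring) a x))).
    { intros j. eapply Rle_trans; [apply He|].
      eapply Rle_trans; [|apply (sum_n_Series_le _ (nn (S j))); auto using ces_term_ge0].
      right. apply sum_n_ext_loc; intros n Hn. apply ces_term_ext; intros k Hk.
      apply dconv_ext; intros i Hi. symmetry. apply Hx. lia. }
    destruct (nfloor_ex (Series (ces_term p (dconv (K := C_Ring) a x)))) as [n Hn].
    { eapply Rle_trans; [|apply (Hj 0%nat)]. simpl; lra. }
    specialize (Hj (S n)). rewrite S_INR in Hj. lra.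
Qed.

End GlidingHump.

Lemma ces_multiplier_bounded (p q : R) (a : nat -> C) : 1 < p -> 1 / p + 1 / q = 1 ->
  in_ces p a -> (forall b, in_ces p b -> in_ces p (dconv (K := C_Ring) a b)) ->
  exists K, forall b N, (forall M, sum_n (ces_term p b) M <= 1) ->
    sum_n (ces_term p (dconv (K := C_Ring) a b)) N <= K.
Proof.
  intros Hp Hpq Ha HT. apply NNPP. intros Hn.
  destruct (gliding_hump p q a Hp Hpq Ha) as [x [Hx Hax]]; [|exact (Hax (HT x Hx))].
  intros K. apply NNPP. intros HK. apply Hn. exists K. intros b N Hb. apply Rnot_lt_le.
  intros Hlt. apply HK. exists b, N. auto.
Qed.

(** * Multipliers are bounded functions *)

(** Coefficients of [(m+1)^(-s)]; in particular [dirac 0] is the unit, the constant function [1]. *)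
Definition dirac (m n : nat) : C := if Nat.eq_dec n m then RtoC 1 else RtoC 0.

Lemma is_series_dterm_finite (a : nat -> C) (m : nat) (s : C) :
  (forall n, (m < n)%nat -> a n = RtoC 0) ->
  is_series (K := C_AbsRing) (V := C_NormedModule) (fun n => (a n * dpow n s)%C)
    (sum_n (fun n => (a n * dpow n s)%C) m).
Proof.
  intros H. apply is_series_C. apply (is_lim_seq_ext_loc (fun _ => 0)); [|apply is_lim_seq_const].
  exists m. intros N HN. rewrite (sum_n_extend _ m N HN).
  - match goal with |- _ = Cmod ?z => replace z with (RtoC 0) by (symmetry; apply Cplus_opp_r) end.
    now rewrite Cmod_0.
  - intros k Hk. rewrite H by lia. apply Cmult_0_l.
Qed.

Lemma dirac_represents (theta : R) (m : nat) : represents theta (dirac m) (dpow m).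
Proof.
  intros s _.
  assert (E : sum_n (fun n => (dirac m n * dpow n s)%C) m = dpow m s).
  { rewrite (sum_n_single _ m); auto.
    - unfold dirac. destruct Nat.eq_dec; [apply Cmult_1_l|lia].
    - intros k _ Hk. unfold dirac. destruct Nat.eq_dec; [lia|apply Cmult_0_l]. }
  rewrite <- E at 1. apply is_series_dterm_finite.
  intros n Hn. unfold dirac. destruct Nat.eq_dec; [lia|auto].
Qed.

Lemma dirac_0_in_ces (p : R) : 1 < p -> in_ces p (dirac 0).
Proof.
  intros Hp. unfold in_ces. apply ex_series_ext with (fun n => Rpower (INR (S n)) (- (p - 1) - 1)).
  2:{ apply ex_series_Rpower. lra. }
  intros n. unfold ces_term. assert (Hn := INR_S_gt0 n).
  replace (sum_n (fun k => Cmod (dirac 0 k)) n) with 1.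
  - rewrite Rmult_1_r, rpow_pos by now apply Rinv_0_lt_compat.
    rewrite <- (Rpower_1 (INR (S n))) at 2 by auto. rewrite <- Rpower_Ropp, Rpower_mult. f_equal. ring.
  - rewrite (sum_n_single _ 0); [|lia|].
    + unfold dirac. destruct Nat.eq_dec; [now rewrite Cmod_1|lia].
    + intros k _ Hk. unfold dirac. destruct Nat.eq_dec; [lia|apply Cmod_0].
Qed.

(** Applying the multiplier to the constant [1] puts [f] itself in [H(ces_p)]; uniqueness of
    coefficients then turns products of functions into convolutions. *)
Lemma multiplier_coef (p q : R) (f : C -> C) : 1 < p -> 1 / p + 1 / q = 1 ->
  multiplier p q f -> exists a, in_ces p a /\ represents (1 / q) a f /\
    forall b, in_ces p b -> in_ces p (dconv (K := C_Ring) a b).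
Proof.
  intros Hp Hpq [_ Hf].
  destruct (Hf (dpow 0)) as [a [Ha Hfa]].
  { exists (dirac 0). split; [now apply dirac_0_in_ces|apply dirac_represents]. }
  replace (Cfun_mult f (dpow 0)) with f in Hfa.
  2:{ apply functional_extensionality; intros s. unfold Cfun_mult. rewrite dpow_0. ring. }
  exists a. split; [|split]; auto. intros b Hb.
  assert (Hba := ces_abs_conv p q b Hp Hpq Hb). assert (Haa := ces_abs_conv p q a Hp Hpq Ha).
  destruct (represents_exists (1 / q) b Hba) as [g Hg].
  destruct (Hf g) as [c [Hc Hfc]]; [now exists b|].
  now rewrite (represents_unique (1 / q) (dconv (K := C_Ring) a b) c (Cfun_mult f g))
    by auto using represents_dconv.
Qed.

Lemma pow_le_geom (x M B : R) : 0 <= x -> 0 < M -> (forall k, x ^ k <= B * M ^ k) -> x <= M.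
Proof.
  intros Hx HM H. apply Rnot_lt_le. intros Hlt.
  assert (L : is_lim_seq (fun k => B * (M / x) ^ k) (B * 0)).
  { apply is_lim_seq_mult'; [apply is_lim_seq_const|]. apply is_lim_seq_geom.
    rewrite Rabs_pos_eq by (apply Rlt_le, Rdiv_lt_0_compat; lra).
    apply Rmult_lt_reg_r with x; [lra|]. unfold Rdiv. rewrite Rmult_assoc, Rinv_l; lra. }
  rewrite Rmult_0_r in L.
  assert (1 <= 0); [|lra].
  refine (is_lim_seq_le (fun _ => 1) _ 1 0 _ (is_lim_seq_const _) L).
  intros k. specialize (H k). unfold Rdiv. rewrite Rpow_mult_distr, pow_inv.
  assert (P : 0 < x ^ k) by (apply pow_lt; lra).
  apply Rmult_le_reg_r with (x ^ k); auto.
  replace (B * (M ^ k * / x ^ k) * x ^ k) with (B * M ^ k) by (field; lra). lra.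
Qed.

(* Point evaluations are bounded on [H(ces_p)], so [|f(s)|^k <= C_s M^k] for the
   powers [f^k = M_f^k 1], and the constant [C_s] disappears as [k -> oo]. *)
Lemma multiplier_point_bound (p q M : R) (f : C -> C) (s : C) : 1 < p -> 1 / p + 1 / q = 1 ->
  multiplier p q f -> half_plane (1 / q) s ->
  (forall g, in_Hces p q g -> Hces_norm p q g <= 1 -> Hces_norm p q (Cfun_mult f g) <= M) ->
  Cmod (f s) <= M.
Proof.
  intros Hp Hpq Hf Hs HM.
  destruct (multiplier_coef p q f Hp Hpq Hf) as [a [Ha [Hfa HT]]].
  assert (Haa := ces_abs_conv p q a Hp Hpq Ha).
  (* [HM] concerns functions in the unit ball. Rescaling by a positive [lam], at least the norm of
     [b], makes it an estimate on sequences without dividing by a norm that may vanish. *)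
  assert (Hscal : forall (b : nat -> C) lam, 0 < lam -> in_ces p b -> ces_norm p b <= lam ->
    ces_norm p (dconv (K := C_Ring) a b) <= M * lam).
  { intros b lam Hl Hb Hbl.
    assert (Hb' := in_ces_scal p (RtoC (/ lam)) b Hb). set (b' := fun k => (RtoC (/ lam) * b k)%C) in *.
    assert (Hba := ces_abs_conv p q b' Hp Hpq Hb').
    assert (Hil := Rinv_0_lt_compat _ Hl).
    destruct (represents_exists (1 / q) b' Hba) as [g Hg].
    assert (H := HM g (ex_intro _ b' (conj Hb' Hg))). unfold Hces_norm in H.
    rewrite (dcoef_represents _ b' g Hg) in H.
    rewrite (dcoef_represents _ (dconv (K := C_Ring) a b') (Cfun_mult f g)) in H by auto using represents_dconv.
    assert (E : dconv (K := C_Ring) a b = (fun k => (RtoC lam * dconv (K := C_Ring) a b' k)%C)).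
    { apply functional_extensionality; intros n. rewrite (dconv_ext a b (fun k => (0 + RtoC lam * b' k)%C)).
      - rewrite dconv_lin. replace (dconv _ (fun _ => RtoC 0) n) with (RtoC 0); [apply Cplus_0_l|].
        symmetry. apply (sum_n_zero (G := C_AbelianMonoid)); intros k _.
        apply (sum_n_zero (G := C_AbelianMonoid)); intros j _.
        destruct Nat.eq_dec; auto. apply Cmult_0_r.
      - intros k _. unfold b'. rewrite Cplus_0_l, Cmult_assoc, <- RtoC_mult, Rinv_r, Cmult_1_l; auto; lra. }
    rewrite E, ces_norm_scal, Cmod_R, Rabs_pos_eq, Rmult_comm by (auto; lra).
    apply Rmult_le_compat_r; [lra|]. apply H. unfold b'.
    rewrite ces_norm_scal, Cmod_R, Rabs_pos_eq by (auto; lra).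
    apply Rmult_le_reg_l with lam; auto. rewrite <- Rmult_assoc, Rinv_r; lra. }
  assert (H1 := dirac_0_in_ces p Hp).
  destruct (in_ces_bound p _ Hp H1) as [lam [Hl Hlam]].
  assert (HM0 : 0 <= M).
  { assert (H := Hscal _ _ Hl H1 Hlam). assert (H0 := ces_norm_ge0 p (dconv (K := C_Ring) a (dirac 0))). nra. }
  (* [M] may be [0], whereas [Hscal] and [pow_le_geom] are applied with positive constants. *)
  apply le_epsilon. intros eps Heps. set (M' := M + eps). assert (HM' : 0 < M') by (unfold M'; lra).
  set (ak := fun k => Nat.iter k (dconv (K := C_Ring) a) (dirac 0)).
  assert (Hak : forall k, in_ces p (ak k) /\ ces_norm p (ak k) <= M' ^ k * lam /\
    represents (1 / q) (ak k) (fun z => f z ^ k)%C).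
  { induction k as [|k [IH1 [IH2 IH3]]].
    - split; [exact H1|split; [simpl; lra|]]. intros z Hz. change (f z ^ 0)%C with (RtoC 1). rewrite <- (dpow_0 z).
      now apply (dirac_represents (1 / q) 0).
    - split; [|split].
      + now apply HT.
      + eapply Rle_trans; [apply (Hscal (ak k) (M' ^ k * lam)); auto|].
        * apply Rmult_lt_0_compat; auto. now apply pow_lt.
        * assert (0 < M' ^ k * lam) by (apply Rmult_lt_0_compat; auto; now apply pow_lt).
          simpl. unfold M' at 2. nra.
      + assert (Hka := ces_abs_conv p q (ak k) Hp Hpq IH1).
        exact (represents_dconv (1 / q) a (ak k) f _ Haa Hka Hfa IH3). }
  destruct (A_term_bound p q (Re s) Hp Hpq Hs) as [K HK].
  apply pow_le_geom with (K * lam); auto using Cmod_ge_0.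
  intros k. destruct (Hak k) as [Hk1 [Hk2 Hk3]].
  assert (Hpos : 0 < M' ^ k * lam) by (apply Rmult_lt_0_compat; auto; now apply pow_lt).
  rewrite <- Cmod_pow.
  refine (is_series_C_Cmod_le _ _ _ (Hk3 s Hs) _). intros N; exists N; split; auto.
  eapply Rle_trans; [apply Cmod_sum_n|].
  replace (K * lam * M' ^ k) with (K * (M' ^ k * lam)) by ring.
  eapply Rle_trans; [|apply (HK (M' ^ k * lam) (ak k) Hpos)].
  - apply sum_n_le; intros n _. rewrite Cmod_dterm. lra.
  - intros N'. now apply sum_n_ces_term_le.
Qed.

Lemma Hinf_norm_le_multiplier_norm (p q : R) (f : C -> C) : 1 < p -> 1 / p + 1 / q = 1 ->
  multiplier p q f -> Rbar_le (Hinf_norm (1 / q) f) (multiplier_norm p q f).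
Proof.
  intros Hp Hpq Hf. unfold Hinf_norm, multiplier_norm.
  apply (proj2 (Lub_Rbar_correct _)). intros x [s [Hs ->]].
  match goal with |- Rbar_le _ (Lub_Rbar ?E) => assert (HE := proj1 (Lub_Rbar_correct E)); destruct (Lub_Rbar E) as [M| |] end.
  - apply (multiplier_point_bound p q M f s); auto.
    intros g Hg Hgn. apply (HE (Hces_norm p q (Cfun_mult f g))). now exists g.
  - exact I.
  (* If the supremum were [m_infty], no [g] would qualify, so every real would be a bound vacuously;
     [-1] contradicts the positivity of the modulus. *)
  - assert (H : Cmod (f s) <= -1).
    { apply (multiplier_point_bound p q (-1) f s); auto.
      intros g Hg Hgn. destruct (HE (Hces_norm p q (Cfun_mult f g))). now exists g. }
    generalize (Cmod_ge_0 (f s)); lra.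
Qed.

Lemma multiplier_in_Hinf (p q : R) (f : C -> C) : 1 < p -> 1 / p + 1 / q = 1 ->
  multiplier p q f -> in_Hinf (1 / q) f.
Proof.
  intros Hp Hpq Hf. destruct (multiplier_coef p q f Hp Hpq Hf) as [a [Ha [Hfa HT]]].
  split; [apply Hf|]. split.
  - destruct (ces_multiplier_bounded p q a Hp Hpq Ha HT) as [K HK].
    (* [K] bounds [p]-th powers of norms, hence the root; the maximum with [1] makes the base
       positive. *)
    set (M := Rpower (Rmax K 1) (1 / p)).
    assert (HM : Rpower M p = Rmax K 1).
    { unfold M. rewrite Rpower_mult. replace (1 / p * p) with 1 by (field; lra).
      apply Rpower_1. generalize (Rmax_r K 1); lra. }
    exists M. intros s Hs. apply (multiplier_point_bound p q M f s); auto.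
    intros g [b [Hb Hg]] Hgn. unfold Hces_norm in *.
    rewrite (dcoef_represents _ b g Hg) in Hgn.
    rewrite (dcoef_represents _ (dconv (K := C_Ring) a b))
      by (apply represents_dconv; auto; now apply ces_abs_conv with p).
    apply ces_norm_le; auto; [apply Rpower_gt0|]. intros N. rewrite HM.
    eapply Rle_trans; [apply HK|apply Rmax_l]. intros m.
    eapply Rle_trans; [apply (sum_n_ces_term_le p 1); auto; lra|].
    unfold Rpower. rewrite ln_1, Rmult_0_r, exp_0. lra.
  - exists (1 / q), a. split; auto. lra.
Qed.

(** * Rudin-Shapiro polynomials *)

Lemma dconv_unit {K : Ring} (d u : nat -> K) (m n : nat) :
  d m = one -> (forall k, k <> m -> d k = zero) ->
  dconv d u n = if Nat.eq_dec (S n mod S m) 0 then u (pred (S n / S m)) else zero.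
Proof.
  intros H1 H0. unfold dconv.
  assert (Hq := Nat.div_mod (S n) (S m) ltac:(lia)).
  assert (Hr := Nat.mod_upper_bound (S n) (S m) ltac:(lia)).
  set (r := (S n mod S m)%nat) in *. set (d' := (S n / S m)%nat) in *.
  clearbody r d'.
  destruct (Nat.eq_dec r 0) as [E|E].
  - destruct d' as [|d']; [exfalso; lia|]. simpl pred.
    assert (Hm : (m <= n)%nat) by nia.
    rewrite (sum_n_single _ m n Hm).
    + assert (Hj : (d' <= n)%nat) by nia.
      rewrite (sum_n_single _ d' n Hj).
      * destruct Nat.eq_dec as [H|H]; [|exfalso; apply H; nia]. rewrite H1. apply mult_one_l.
      * intros j _ Hj'. destruct Nat.eq_dec as [H|H]; auto. exfalso. nia.
    + intros k _ Hk. apply sum_n_zero; intros j _. destruct Nat.eq_dec; auto.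
      rewrite H0 by auto. apply mult_zero_l.
  - apply sum_n_zero; intros k _. apply sum_n_zero; intros j _.
    destruct Nat.eq_dec as [H|H]; auto.
    destruct (Nat.eq_dec k m) as [->|Hk]; [|rewrite H0 by auto; apply mult_zero_l].
    exfalso. destruct (le_lt_dec (S j) d'); nia.
Qed.

Lemma dconv_dirac (u : nat -> C) (m n : nat) : dconv (K := C_Ring) (dirac m) u n
  = if Nat.eq_dec (S n mod S m) 0 then u (pred (S n / S m)) else RtoC 0.
Proof.
  apply (dconv_unit (K := C_Ring)); unfold dirac.
  - destruct Nat.eq_dec; [reflexivity|lia].
  - intros k Hk. destruct Nat.eq_dec; [lia|reflexivity].
Qed.

Lemma dconv_dirac_support (u : nat -> C) (m n A B : nat) :
  (forall k, u k <> RtoC 0 -> (A <= S k <= B)%nat) ->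
  dconv (K := C_Ring) (dirac m) u n <> RtoC 0 ->
  exists k, (S n = S m * k)%nat /\ (A <= k <= B)%nat.
Proof.
  intros Hu. rewrite dconv_dirac. destruct Nat.eq_dec as [E|E]; [|intros H; now destruct H].
  intros H. apply Hu in H. exists (S n / S m)%nat.
  assert (Hq := Nat.div_mod (S n) (S m) ltac:(lia)).
  destruct (S n / S m)%nat; [exfalso; lia|]. simpl pred in H. lia.
Qed.

Lemma is_series_dirac (m : nat) : is_series (fun n => Cmod (dirac m n)) 1.
Proof.
  change (is_lim_seq (sum_n (fun n => Cmod (dirac m n))) 1).
  apply (is_lim_seq_ext_loc (fun _ => 1)); [|apply is_lim_seq_const].
  exists m. intros N HN. rewrite (sum_n_single _ m N HN).
  - unfold dirac. destruct Nat.eq_dec; [now rewrite Cmod_1|lia].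
  - intros k _ Hk. unfold dirac. destruct Nat.eq_dec; [lia|apply Cmod_0].
Qed.

(** Dilation is injective on frequencies, so nothing cancels: the moduli of the convolution are the
    convolution of the moduli, and [dirac m] has sum [1]. *)
Lemma is_series_Cmod_dconv_dirac (u : nat -> C) (m : nat) (l : R) :
  is_series (fun n => Cmod (u n)) l ->
  is_series (fun n => Cmod (dconv (K := C_Ring) (dirac m) u n)) l.
Proof.
  intros Hu.
  assert (H := is_series_dconv_ge0 (fun n => Cmod (dirac m n)) (fun n => Cmod (u n))
    (fun k => Cmod_ge_0 _) (fun k => Cmod_ge_0 _) (ex_intro _ _ (is_series_dirac m)) (ex_intro _ _ Hu)).
  rewrite (is_series_unique _ _ Hu), (is_series_unique _ _ (is_series_dirac m)), Rmult_1_l in H.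
  revert H. apply is_series_ext. intros n. rewrite dconv_dirac.
  etransitivity; [apply (dconv_unit (K := R_Ring) _ _ m)|].
  - unfold dirac. destruct Nat.eq_dec; [apply Cmod_1|lia].
  - intros k Hk. unfold dirac. destruct Nat.eq_dec; [lia|apply Cmod_0].
  - destruct Nat.eq_dec; auto. symmetry; apply Cmod_0.
Qed.

Lemma is_series_dconv_dirac (u : nat -> C) (m : nat) (s l : C) :
  0 <= Re s -> ex_series (fun n => Cmod (u n)) ->
  is_series (K := C_AbsRing) (V := C_NormedModule) (fun n => (u n * dpow n s)%C) l ->
  is_series (K := C_AbsRing) (V := C_NormedModule)
    (fun n => (dconv (K := C_Ring) (dirac m) u n * dpow n s)%C) (dpow m s * l)%C.
Proof.
  intros Hs Hu Hl.
  apply is_series_ext with (dconv (K := C_Ring) (fun k => (dirac m k * dpow k s)%C) (fun k => (u k * dpow k s)%C)).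
  { intros n. apply dconv_dpow. }
  assert (Hd : forall v : nat -> C, ex_series (fun n => Cmod (v n)) -> ex_series (fun n => Cmod (v n * dpow n s)%C)).
  { intros v. apply ex_series_le_R. intros n. split; [apply Cmod_ge_0|].
    rewrite Cmod_dterm. unfold A_term.
    assert (H : Rpower (INR (S n)) (- Re s) <= Rpower (INR (S n)) 0) by (apply Rle_Rpower; [apply INR_S_ge1|lra]).
    rewrite Rpower_O in H by apply INR_S_gt0. generalize (Cmod_ge_0 (v n)); nra. }
  apply is_series_dconv; auto.
  - apply (dirac_represents (Re s - 1) m). unfold half_plane; lra.
  - apply Hd. exists 1. apply is_series_dirac.
Qed.

(** [A] and [B] bound the integers [n+1], not the indices. [rs_large] says [A >= 2^(2^t)], so that
    blocks are sparse enough for absolute convergence; [rs_eval] carries the quantity that the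
    parallelogram law doubles. Of unimodularity only the [l^1] norm [2^t] is recorded. *)
Record rudin_shapiro_pair (t : nat) (P Q : nat -> C) (A B : nat) : Prop := {
  rs_range : (2 <= A <= B)%nat /\ (B < 2 * A)%nat;
  rs_large : 2 ^ t * ln 2 <= ln (INR A);
  rs_suppP : forall n, P n <> RtoC 0 -> (A <= S n <= B)%nat;
  rs_suppQ : forall n, Q n <> RtoC 0 -> (A <= S n <= B)%nat;
  rs_sumP : is_series (fun n => Cmod (P n)) (2 ^ t);
  rs_sumQ : is_series (fun n => Cmod (Q n)) (2 ^ t);
  rs_eval : forall s, 0 <= Re s -> exists x y : C,
    is_series (K := C_AbsRing) (V := C_NormedModule) (fun n => (P n * dpow n s)%C) x /\
    is_series (K := C_AbsRing) (V := C_NormedModule) (fun n => (Q n * dpow n s)%C) y /\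
    Cmod x ^ 2 + Cmod y ^ 2 <= 2 * 2 ^ t
}.

Lemma Cmod_dpow_le_1 (m : nat) (s : C) : 0 <= Re s -> Cmod (dpow m s) <= 1.
Proof.
  intros Hs. rewrite Cmod_dpow, <- (Rpower_O (INR (S m))) by apply INR_S_gt0.
  apply Rle_Rpower; [apply INR_S_ge1|lra].
Qed.

Lemma parallelogram (z w : C) :
  Cmod (z + w)%C ^ 2 + Cmod (z - w)%C ^ 2 = 2 * (Cmod z ^ 2 + Cmod w ^ 2).
Proof.
  rewrite !Cmod2_alt. destruct z as [z1 z2], w as [w1 w2].
  unfold Cplus, Cminus, Copp, Re, Im; simpl. ring.
Qed.

(** The Rudin-Shapiro combination [P + Q], [P - Q] for [c = 1, -1], with frequencies dilated by
    [m+1] and [m+2]. On [Re s >= 0] a dilation multiplies the value by a factor of modulus at most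
    [1]. *)
Definition rs_comb (m : nat) (c : C) (P Q : nat -> C) (n : nat) : C :=
  (dconv (K := C_Ring) (dirac m) P n + c * dconv (K := C_Ring) (dirac (S m)) Q n)%C.

(* Multiplying the frequencies of [P] by [B + 1] and those of [Q] by [B + 2]
   makes them disjoint, because [(B + 1) k = (B + 2) k'] forces [B < k']. *)
Lemma rs_comb_disjoint (P Q : nat -> C) (A B n : nat) :
  (forall k, P k <> RtoC 0 -> (A <= S k <= B)%nat) ->
  (forall k, Q k <> RtoC 0 -> (A <= S k <= B)%nat) -> (1 <= A)%nat ->
  dconv (K := C_Ring) (dirac B) P n = RtoC 0 \/ dconv (K := C_Ring) (dirac (S B)) Q n = RtoC 0.
Proof.
  intros HP HQ HA. apply NNPP. intros H. apply not_or_and in H as [H1 H2].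
  apply (dconv_dirac_support P B n A B HP) in H1 as [k [E1 K1]].
  apply (dconv_dirac_support Q (S B) n A B HQ) in H2 as [k' [E2 K2]].
  assert (E : (S B * k = S (S B) * k')%nat) by lia.
  assert ((k > k')%nat) by nia. nia.
Qed.

Lemma rs_comb_support (c : C) (P Q : nat -> C) (A B n : nat) :
  (forall k, P k <> RtoC 0 -> (A <= S k <= B)%nat) ->
  (forall k, Q k <> RtoC 0 -> (A <= S k <= B)%nat) ->
  rs_comb B c P Q n <> RtoC 0 -> (S B * A <= S n <= S (S B) * B)%nat.
Proof.
  intros HP HQ H. unfold rs_comb in H.
  destruct (classic (dconv (K := C_Ring) (dirac B) P n = RtoC 0)) as [E1|E1].
  - destruct (classic (dconv (K := C_Ring) (dirac (S B)) Q n = RtoC 0)) as [E2|E2].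
    + exfalso. apply H. rewrite E1, E2. ring.
    + apply (dconv_dirac_support Q (S B) n A B HQ) in E2 as [k [E K]]. nia.
  - apply (dconv_dirac_support P B n A B HP) in E1 as [k [E K]]. nia.
Qed.

Lemma rs_comb_sum (c : C) (P Q : nat -> C) (A B : nat) (l : R) : Cmod c = 1 ->
  (forall k, P k <> RtoC 0 -> (A <= S k <= B)%nat) ->
  (forall k, Q k <> RtoC 0 -> (A <= S k <= B)%nat) -> (1 <= A)%nat ->
  is_series (fun n => Cmod (P n)) l -> is_series (fun n => Cmod (Q n)) l ->
  is_series (fun n => Cmod (rs_comb B c P Q n)) (2 * l).
Proof.
  intros Hc HP HQ HA SP SQ.
  assert (H := is_series_plus (K := R_AbsRing) (V := R_NormedModule) _ _ _ _
    (is_series_Cmod_dconv_dirac P B l SP) (is_series_Cmod_dconv_dirac Q (S B) l SQ)).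
  replace (2 * l) with (plus l l) by (change (l + l = 2 * l); ring).
  revert H. apply is_series_ext. intros n. unfold rs_comb. change plus with Rplus.
  destruct (rs_comb_disjoint P Q A B n HP HQ HA) as [E|E]; rewrite E.
  - rewrite Cmod_0, Rplus_0_l, Cplus_0_l, Cmod_mult, Hc, Rmult_1_l. reflexivity.
  - rewrite Cmod_0, Rplus_0_r, Cmult_0_r, Cplus_0_r. reflexivity.
Qed.

Lemma rs_comb_eval (c : C) (P Q : nat -> C) (B : nat) (s x y : C) : 0 <= Re s ->
  ex_series (fun n => Cmod (P n)) -> ex_series (fun n => Cmod (Q n)) ->
  is_series (K := C_AbsRing) (V := C_NormedModule) (fun n => (P n * dpow n s)%C) x ->
  is_series (K := C_AbsRing) (V := C_NormedModule) (fun n => (Q n * dpow n s)%C) y ->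
  is_series (K := C_AbsRing) (V := C_NormedModule) (fun n => (rs_comb B c P Q n * dpow n s)%C)
    (dpow B s * x + c * (dpow (S B) s * y))%C.
Proof.
  intros Hs SP SQ Hx Hy.
  assert (H := is_series_plus (K := C_AbsRing) (V := C_NormedModule) _ _ _ _
    (is_series_dconv_dirac P B s x Hs SP Hx)
    (is_series_scal (K := C_AbsRing) (V := C_NormedModule) c _ _ (is_series_dconv_dirac Q (S B) s y Hs SQ Hy))).
  revert H. apply is_series_ext. intros n. unfold rs_comb.
  change plus with Cplus. change scal with Cmult.
  match goal with |- ?x = ?y => change (@eq C x y) end. ring.
Qed.

Lemma rudin_shapiro_step (t : nat) (P Q : nat -> C) (A B : nat) :
  rudin_shapiro_pair t P Q A B ->
  rudin_shapiro_pair (S t) (rs_comb B 1 P Q) (rs_comb B (- (1)) P Q) (S B * A) (S (S B) * B).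
Proof.
  intros [[R1 R2] L SP SQ TP TQ E].
  assert (HA : (1 <= A)%nat) by lia.
  split.
  (* From [B + 1 <= 2 A] follows [B (B+2) < (B+1)^2 <= 2 A (B+1)]: the new block is again dyadic. *)
  - nia.
  (* [(B+1) A >= A^2], so the logarithm at least doubles, as [2^t] does. *)
  - rewrite mult_INR, ln_mult by (try apply INR_S_gt0; apply lt_0_INR; lia).
    assert (ln (INR A) <= ln (INR (S B))) by (apply ln_le; [apply lt_0_INR; lia|apply le_INR; lia]).
    simpl pow. lra.
  - intros n. now apply rs_comb_support.
  - intros n. now apply rs_comb_support.
  - simpl pow. apply rs_comb_sum with A; auto using Cmod_1.
  - simpl pow. apply rs_comb_sum with A; auto. now rewrite Cmod_opp, Cmod_1.
  - intros s Hs. destruct (E s Hs) as [x [y [Hx [Hy Hxy]]]].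
    eexists. eexists. split; [|split].
    + apply rs_comb_eval; eauto; eexists; eauto.
    + apply rs_comb_eval; eauto; eexists; eauto.
    + set (u := dpow B s). set (v := dpow (S B) s).
      replace (u * x + 1 * (v * y))%C with (u * x + v * y)%C by ring.
      replace (u * x + - (1) * (v * y))%C with (u * x - v * y)%C by ring.
      rewrite parallelogram, !Cmod_mult.
      assert (Hu : Cmod u <= 1) by now apply Cmod_dpow_le_1.
      assert (Hv : Cmod v <= 1) by now apply Cmod_dpow_le_1.
      assert (Hu0 := Cmod_ge_0 u). assert (Hv0 := Cmod_ge_0 v).
      assert (Hu2 : Cmod u ^ 2 <= 1) by nra. assert (Hv2 : Cmod v ^ 2 <= 1) by nra.
      rewrite !Rpow_mult_distr. simpl (2 ^ S t).
      assert (Hx2 := pow2_ge_0 (Cmod x)). assert (Hy2 := pow2_ge_0 (Cmod y)).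
      assert (Cmod u ^ 2 * Cmod x ^ 2 <= Cmod x ^ 2) by nra.
      assert (Cmod v ^ 2 * Cmod y ^ 2 <= Cmod y ^ 2) by nra.
      lra.
Qed.

(** The start is [2^(-s)] rather than the constant [1], because [rs_large] requires [A >= 2]. *)
Lemma rudin_shapiro_base : rudin_shapiro_pair 0 (dirac 1) (dirac 1) 2 2.
Proof.
  assert (H : forall n, dirac 1 n <> RtoC 0 -> (2 <= S n <= 2)%nat).
  { intros n. unfold dirac. destruct Nat.eq_dec; [lia|]. intros Hn; now destruct Hn. }
  split; auto using is_series_dirac.
  - lia.
  - simpl pow. replace (INR 2) with 2 by (simpl; ring). lra.
  - intros s Hs. exists (dpow 1 s), (dpow 1 s).
    assert (D := dirac_represents (Re s - 1) 1 s ltac:(unfold half_plane; lra)).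
    split; [exact D|split; [exact D|]].
    assert (H1 := Cmod_dpow_le_1 1 s Hs). assert (H0 := Cmod_ge_0 (dpow 1 s)). simpl (2 ^ 0). nra.
Qed.

Lemma rudin_shapiro_blocks : exists (P : nat -> nat -> C) (A B : nat -> nat),
  (forall t, exists Q, rudin_shapiro_pair t (P t) Q (A t) (B t)) /\
  (forall t, (B t < A (S t))%nat).
Proof.
  set (X := nat_rect (fun _ => ((nat -> C) * (nat -> C) * (nat * nat))%type)
    (dirac 1, dirac 1, (2, 2))%nat
    (fun _ st => let '(P, Q, (A, B)) := st in
       (rs_comb B 1 P Q, rs_comb B (- (1)) P Q, (S B * A, S (S B) * B)%nat))).
  exists (fun t => fst (fst (X t))), (fun t => fst (snd (X t))), (fun t => snd (snd (X t))).
  assert (H : forall t, rudin_shapiro_pair t (fst (fst (X t))) (snd (fst (X t))) (fst (snd (X t))) (snd (snd (X t)))).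
  { induction t as [|t IH]; [exact rudin_shapiro_base|].
    apply rudin_shapiro_step in IH. simpl X. revert IH. destruct (X t) as [[P Q] [A B]]. auto. }
  split.
  - intros t. eexists. apply H.
  - intros t. specialize (H t). simpl X. destruct (X t) as [[P Q] [A B]]. simpl in *.
    destruct (rs_range _ _ _ _ _ H). nia.
Qed.

(** * A bounded function that is not a multiplier *)

Lemma sum_n_eventually_const (u : nat -> R) (N : nat) (l : R) :
  is_series u l -> (forall n, (N < n)%nat -> u n = 0) -> sum_n u N = l.
Proof.
  intros H H0.
  assert (L : is_lim_seq (sum_n u) (sum_n u N)).
  { apply (is_lim_seq_ext_loc (fun _ => sum_n u N)); [|apply is_lim_seq_const].
    exists N. intros M HM. symmetry.
    apply (sum_n_extend (G := R_AbelianMonoid)); auto. intros k Hk. apply H0. lia. }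
  apply is_lim_seq_unique in L. assert (L' := is_lim_seq_unique (sum_n u) l H).
  rewrite L in L'. now injection L'.
Qed.

Lemma bounded_nonmultiplier (p q : R) : 1 < p -> 1 / p + 1 / q = 1 ->
  exists f : C -> C, in_Hinf (1 / q) f /\ ~ multiplier p q f.
Proof.
  intros Hp Hpq. destruct (conjugate_bounds p q Hp Hpq) as [_ Ht].
  set (th := 1 / q) in *.
  destruct rudin_shapiro_blocks as [P [A [B [HP HAB]]]].
  assert (HA : forall t, (2 <= A t <= B t)%nat /\ (B t < 2 * A t)%nat).
  { intros t. destruct (HP t) as [Q H]. apply H. }
  assert (Hlarge : forall t, 2 ^ t * ln 2 <= ln (INR (A t))).
  { intros t. destruct (HP t) as [Q H]. apply H. }
  assert (Hsupp : forall t n, P t n <> RtoC 0 -> (A t <= S n <= B t)%nat).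
  { intros t n. destruct (HP t) as [Q H]. apply H. }
  assert (Hsum : forall t, is_series (fun n => Cmod (P t n)) (2 ^ t)).
  { intros t. destruct (HP t) as [Q H]. apply H. }
  assert (Hord : forall t t', (t < t')%nat -> (B t < A t')%nat).
  { induction 1 as [|t' Htt' IH]; [apply HAB|]. specialize (HAB t'). specialize (HA t'). lia. }
  assert (Hbig : forall t, (t < A t)%nat).
  { induction t as [|t IH]; [specialize (HA 0%nat); lia|]. specialize (HAB t). specialize (HA t). lia. }
  assert (Hzero : forall t n, (S n < A t \/ B t < S n)%nat -> P t n = RtoC 0).
  { intros t n H. apply NNPP. intros H'. apply Hsupp in H'. lia. }
  set (c := fun t : nat => (2 / 3) ^ t).
  assert (Hc : forall t, 0 < c t) by (intros; apply pow_lt; lra).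
  (* The factor [(n+1)^th] realizes the translation from [P_t(s)] to [P_t(s - th)]. *)
  set (term := fun n t => (RtoC (c t * Rpower (INR (S n)) th) * P t n)%C).
  (* Cutting the sum over blocks at [n] loses nothing: for [t > n] the block starts at [A t > t],
     beyond [n+1]. *)
  set (a := fun n => sum_n (term n) n).
  assert (Ha : forall T n, (S n <= B T)%nat -> a n = sum_n (term n) T).
  { intros T n HT. unfold a. transitivity (sum_n (term n) (max n T)); [symmetry|];
      apply (sum_n_extend (G := C_AbelianMonoid)); try lia.
    - intros t Ht'. unfold term. rewrite Hzero; [apply Cmult_0_r|]. left. specialize (Hbig t). lia.
    - intros t Ht'. unfold term. rewrite Hzero; [apply Cmult_0_r|]. left.
      assert (H := Hord T t ltac:(lia)). lia. }
  assert (Hterm : forall n t, Cmod (term n t) = c t * Rpower (INR (S n)) th * Cmod (P t n)).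
  { intros n t. unfold term. rewrite Cmod_mult, Cmod_R, Rabs_pos_eq; auto.
    apply Rmult_le_pos; left; [apply Hc|apply Rpower_gt0]. }
  (* Block [t] contributes at most [c t * A^(-d) * 2^t] with [d = sg - th], and
     [A^d >= d ln A >= d 2^t ln 2] absorbs the factor [2^t]. *)
  assert (Habs : abs_conv th a).
  { intros sg Hsg. set (d := sg - th). assert (Hd : 0 < d) by (unfold d; lra).
    assert (Hln2 : 0 < ln 2) by (rewrite <- ln_1; apply ln_increasing; lra).
    assert (Hi : 0 < / (d * ln 2)) by (apply Rinv_0_lt_compat, Rmult_lt_0_compat; auto).
    apply ex_series_bounded with (/ (d * ln 2) * 3); [apply A_term_ge0|]. intros N.
    apply Rle_trans with (sum_n (fun t => / (d * ln 2) * c t) N).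
    2:{ rewrite sum_n_scal. apply Rmult_le_compat_l; [lra|].
        (* The exact value of the geometric sum of ratio [2/3]. *)
        apply Rle_trans with (3 - 2 * c N); [|specialize (Hc N); lra]. clear.
        induction N as [|N IH]; [rewrite sum_O; unfold c; simpl; lra|]. rewrite sum_n_S.
        unfold c in *. simpl pow. lra. }
    apply Rle_trans with (sum_n (fun n => sum_n (fun t =>
      c t * Rpower (INR (A t)) (- d) * Cmod (P t n)) N) N).
    - apply sum_n_le; intros n Hn. unfold A_term.
      apply Rle_trans with (sum_n (fun t => c t * Rpower (INR (A t)) (- d) * Cmod (P t n)) n).
      2:{ refine (sum_n_le_n _ n N _ Hn). intros t. apply Rmult_le_pos; [|apply Cmod_ge_0].
          apply Rmult_le_pos; left; [apply Hc|apply Rpower_gt0]. }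
      eapply Rle_trans; [apply Rmult_le_compat_r; [left; apply Rpower_gt0|apply Cmod_sum_n]|].
      rewrite Rmult_comm, <- sum_n_scal. apply sum_n_le; intros t _. rewrite Hterm.
      destruct (classic (P t n = RtoC 0)) as [E|E]; [rewrite E, Cmod_0; right; ring|].
      apply Hsupp in E.
      replace (Rpower (INR (S n)) (- sg) * (c t * Rpower (INR (S n)) th * Cmod (P t n)))
        with (c t * (Rpower (INR (S n)) th * Rpower (INR (S n)) (- sg)) * Cmod (P t n)) by ring.
      rewrite <- Rpower_plus. replace (th + - sg) with (- d) by (unfold d; ring).
      apply Rmult_le_compat_r; [apply Cmod_ge_0|]. apply Rmult_le_compat_l; [left; apply Hc|].
      rewrite !Rpower_Ropp. apply Rinv_le_contravar; [apply Rpower_gt0|].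
      apply Rle_Rpower_l; [lra|]. specialize (HA t). split; [apply lt_0_INR|apply le_INR]; lia.
    - rewrite sum_n_switch. apply sum_n_le; intros t _. rewrite sum_n_scal.
      apply Rle_trans with (c t * Rpower (INR (A t)) (- d) * 2 ^ t).
      { apply Rmult_le_compat_l.
        - apply Rmult_le_pos; left; [apply Hc|apply Rpower_gt0].
        - rewrite <- (is_series_unique _ _ (Hsum t)). apply sum_n_Series_le; [intros; apply Cmod_ge_0|].
          eexists; apply Hsum. }
      rewrite Rmult_assoc, Rmult_comm. apply Rmult_le_compat_r; [left; apply Hc|].
      rewrite Rpower_Ropp. apply Rmult_le_reg_l with (Rpower (INR (A t)) d); [apply Rpower_gt0|].
      assert (H0 := Rpower_gt0 (INR (A t)) d).
      replace (Rpower (INR (A t)) d * (/ Rpower (INR (A t)) d * 2 ^ t)) with (2 ^ t) by (field; lra).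
      assert (H1 : d * (2 ^ t * ln 2) <= Rpower (INR (A t)) d).
      { unfold Rpower. apply Rle_trans with (d * ln (INR (A t))).
        - apply Rmult_le_compat_l; [lra|apply Hlarge].
        - generalize (exp_ge_1_plus (d * ln (INR (A t)))); lra. }
      apply Rmult_le_reg_r with (d * ln 2); [now apply Rmult_lt_0_compat|].
      replace (Rpower (INR (A t)) d * / (d * ln 2) * (d * ln 2)) with (Rpower (INR (A t)) d) by (field; lra).
      lra. }
  destruct (represents_exists th a Habs) as [f Hf].
  exists f. split.
  - split; [now apply analytic_on_represents with a|]. split; [|exists th, a; split; auto; lra].
    set (r := 2 / 3 * sqrt 2).
    assert (Hs2 : 0 <= sqrt 2 < 3 / 2).
    { split; [apply sqrt_pos|]. replace (3 / 2) with (sqrt (Rsqr (3 / 2))) by (apply sqrt_Rsqr; lra).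
      apply sqrt_lt_1_alt. unfold Rsqr. lra. }
    assert (Hr : 0 <= r < 1) by (unfold r; lra).
    exists (Series (fun t => sqrt 2 * r ^ t)). intros s Hs. unfold half_plane in Hs.
    assert (Er : ex_series (fun t => sqrt 2 * r ^ t)).
    { apply (ex_series_scal (K := R_AbsRing) (V := R_NormedModule) (sqrt 2)).
      apply ex_series_geom. rewrite Rabs_pos_eq; lra. }
    apply (is_series_C_Cmod_le _ _ _ (Hf s Hs)). intros T.
    (* Partial sums are taken at the last frequency of block [T], where all blocks up to [T] are
       complete and [rs_eval] applies to each. *)
    exists (pred (B T)). split; [specialize (HA T); specialize (Hbig T); lia|].
    eapply Rle_trans; [|apply (sum_n_Series_le _ T); auto].
    2:{ intros t. apply Rmult_le_pos; [lra|apply pow_le; lra]. }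
    set (s' := (s - RtoC th)%C).
    assert (Hs' : 0 <= Re s') by (unfold s', Re, Cminus, Cplus, Copp, RtoC in *; simpl; unfold Re in Hs; lra).
    assert (Hdp : forall n, (RtoC (Rpower (INR (S n)) th) * dpow n s)%C = dpow n s').
    { intros n. unfold s', Cminus. rewrite dpow_plus, Cmult_comm. f_equal.
      unfold dpow, Cexp, Rpower. generalize (ln (INR (S n))); intros L.
      replace (Cmult (Copp (Copp (RtoC th))) (RtoC L)) with (RtoC (th * L))
        by (rewrite RtoC_mult; ring).
      unfold Re, Im, RtoC; simpl fst; simpl snd. rewrite cos_0, sin_0. f_equal; ring. }
    assert (E : sum_n (fun n => (a n * dpow n s)%C) (pred (B T)) =
      sum_n (fun t => (RtoC (c t) * sum_n (fun n => (P t n * dpow n s')%C) (pred (B T)))%C) T).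
    { transitivity (sum_n (fun n => sum_n (fun t => (RtoC (c t) * (P t n * dpow n s'))%C) T) (pred (B T))).
      - apply sum_n_ext_loc; intros n Hn. rewrite (Ha T n) by (specialize (HA T); lia).
        etransitivity; [symmetry; apply (sum_n_mult_r (K := C_Ring))|].
        apply sum_n_ext; intros t. unfold term. rewrite <- Hdp, RtoC_mult.
        change mult with Cmult. match goal with |- ?x = ?y => change (@eq C x y) end. ring.
      - rewrite sum_n_switch. apply sum_n_ext; intros t. apply (sum_n_mult_l (K := C_Ring)). }
    rewrite E. eapply Rle_trans; [apply Cmod_sum_n|]. apply sum_n_le; intros t Ht'.
    rewrite Cmod_mult, Cmod_R, Rabs_pos_eq by (left; apply Hc).
    destruct (HP t) as [Q HQ]. destruct (rs_eval _ _ _ _ _ HQ s' Hs') as [x [y [Hx [_ Hxy]]]].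
    assert (Hvan : forall n, (pred (B T) < n)%nat -> P t n = RtoC 0).
    { intros n Hn. apply Hzero. right. destruct (Nat.eq_dec t T) as [->|Hne]; [lia|].
      specialize (Hord t T ltac:(lia)). specialize (HA T). lia. }
    assert (Hfin := is_series_dterm_finite (P t) (pred (B T)) s').
    rewrite (is_series_C_unique _ _ x (Hfin Hvan) Hx).
    assert (Hx2 : Cmod x <= sqrt 2 * sqrt 2 ^ t).
    { apply Rsqr_incr_0.
      - unfold Rsqr. replace (sqrt 2 * sqrt 2 ^ t * (sqrt 2 * sqrt 2 ^ t)) with
          (sqrt 2 * sqrt 2 * (sqrt 2 * sqrt 2) ^ t) by (rewrite Rpow_mult_distr; ring).
        rewrite sqrt_sqrt by lra. generalize (pow2_ge_0 (Cmod y)). nra.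
      - apply Cmod_ge_0.
      - apply Rmult_le_pos; [lra|apply pow_le; lra]. }
    replace (sqrt 2 * r ^ t) with (c t * (sqrt 2 * sqrt 2 ^ t))
      by (unfold r, c; rewrite Rpow_mult_distr; ring).
    apply Rmult_le_compat_l; [left; apply Hc|exact Hx2].
  - intros Hm. destruct (multiplier_coef p q f Hp Hpq Hm) as [a' [Ha' [Hfa' _]]].
    rewrite (represents_unique th a' a f Hfa' Hf) in Ha'.
    destruct (in_ces_bound p a Hp Ha') as [M [HM HaM]].
    assert (G := fun n => ces_growth p q M a n Hp Hpq HM (fun N => sum_n_ces_term_le p M a N Hp HM Ha' HaM)).
    fold th in G.
    (* Block [T] alone contributes [(2/3)^T 2^T A^th] to the sum up to [B], which [ces_growth]
       bounds by [2 M B^th]; the block is dyadic, so [B^th <= 2 A^th], whence [4 M]. *)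
    assert (H43 : forall T, (4 / 3) ^ T <= 4 * M).
    { intros T. specialize (G (pred (B T))). specialize (HA T).
      replace (S (pred (B T))) with (B T) in G by lia.
      assert (HAT : 0 < INR (A T)) by (apply lt_0_INR; lia).
      assert (H1 : c T * Rpower (INR (A T)) th * 2 ^ T <= sum_n (fun n => Cmod (a n)) (pred (B T))).
      { rewrite <- (sum_n_eventually_const _ (pred (B T)) _ (Hsum T)).
        2:{ intros n Hn. rewrite Hzero, Cmod_0; auto. lia. }
        rewrite <- sum_n_scal. apply sum_n_le; intros n Hn.
        destruct (classic (P T n = RtoC 0)) as [E|E].
        { rewrite E, Cmod_0, Rmult_0_r. apply Cmod_ge_0. }
        apply Hsupp in E. rewrite (Ha T n) by lia.
        rewrite (sum_n_single (G := C_AbelianMonoid) (term n) T T); auto.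
        2:{ intros t Ht' Hne. unfold term. rewrite Hzero; [apply Cmult_0_r|].
            specialize (Hord t T ltac:(lia)). lia. }
        rewrite Hterm. apply Rmult_le_compat_r; [apply Cmod_ge_0|].
        apply Rmult_le_compat_l; [left; apply Hc|]. apply Rle_Rpower_l; [lra|].
        split; auto. apply le_INR; lia. }
      assert (H2 : Rpower (INR (B T)) th <= 2 * Rpower (INR (A T)) th).
      { apply Rle_trans with (Rpower (2 * INR (A T)) th).
        - apply Rle_Rpower_l; [lra|]. split; [apply lt_0_INR; lia|].
          rewrite <- (mult_INR 2). apply le_INR. lia.
        - rewrite <- Rpower_mult_distr by lra. apply Rmult_le_compat_r; [left; apply Rpower_gt0|].
          rewrite <- (Rpower_1 2) at 2 by lra. apply Rle_Rpower; lra. }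
      assert (H3 := Rpower_gt0 (INR (A T)) th).
      apply Rmult_le_reg_r with (Rpower (INR (A T)) th); auto.
      replace ((4 / 3) ^ T) with (c T * 2 ^ T) by (unfold c; rewrite <- Rpow_mult_distr; f_equal; field).
      nra. }
    destruct (Pow_x_infinity (4 / 3) ltac:(rewrite Rabs_pos_eq; lra) (4 * M + 1)) as [N HN].
    specialize (HN N (le_n N)). rewrite Rabs_pos_eq in HN by (apply pow_le; lra).
    specialize (H43 N). lra.
Qed.

Theorem theorem4p5 (p q : R) (hp : 1 < p) (hpq : 1 / p + 1 / q = 1) :
  (forall f : C -> C, in_A (1 / q) f -> multiplier p q f) /\
  (forall f : C -> C, multiplier p q f -> in_Hinf (1 / q) f) /\
  (exists f : C -> C, in_Hinf (1 / q) f /\ ~ multiplier p q f) /\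
  (forall f : C -> C, in_A (1 / q) f ->
     Rbar_le (multiplier_norm p q f) (Finite (A_norm (1 / q) f))) /\
  (forall f : C -> C, multiplier p q f ->
     Rbar_le (Hinf_norm (1 / q) f) (multiplier_norm p q f)).
Proof.
  split; [|split; [|split; [|split]]].
  - intros f. now apply A_multiplier.
  - intros f. now apply multiplier_in_Hinf.
  - now apply bounded_nonmultiplier.
  - intros f. now apply A_multiplier_norm.
  - intros f. now apply Hinf_norm_le_multiplier_norm.
Qed.
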